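(* Let $p\ge 1$, $n\ge 1$, $I=[t,T]$ a compact interval, and let $\Lambda:I\times\mathbb R^n\times\mathbb R^n\to[0,+\infty]$ and $\Psi:I\times\mathbb R^n\to[0,+\infty]$ be Borel functions, with $\{(s,z,u):\Lambda(s,z,u)<+\infty\}=I\times D_\Lambda$ for some $D_\Lambda\subseteq\mathbb R^n\times\mathbb R^n$. For $y\in W^{1,p}(I;\mathbb R^n)$ put $F(y)=\int_t^T\Lambda(s,y(s),y'(s))\Psi(s,y(s))\,ds$. Assume that $\Lambda$ satisfies Condition (S): for every $K\ge 0$ there exist $\kappa,\beta\ge 0$, $\gamma\in L^1(I)$ and $\varepsilon_*>0$ such that for a.e. $s\in I$, $$|\Lambda(s_2,z,v)-\Lambda(s_1,z,v)|\le\big(\kappa\Lambda(s,z,v)+\beta|v|^p+\gamma(s)\big)|s_2-s_1|$$ whenever $s_1,s_2\in[s-\varepsilon_*,s+\varepsilon_*]\cap I$, $|z|\le K$, $v\in\mathbb R^n$ and $\Lambda(s,z,v)<+\infty$. Let $y\in W^{1,p}(I;\mathbb R^n)$ be such that $s\mapsto\Lambda(s,y(s),y'(s))\Psi(s,y(s))$ belongs to $L^1(I)$ and $s\mapsto \Lambda(s,y(s),y'(s))$ belongs to $L^1(I)$. Suppose there is a neighbourhood $\mathcal O_y$ of $y(I)$ in $\mathbb R^n$ such that: (i) $\Psi$ is bounded on $I\times\mathcal O_y$; (ii) $\Psi(\cdot,z)$ is continuous on $I$ for every $z\in y(I)$; (iii) there is $\nu_0>0$ such that $\Lambda$ is bounded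 on $I\times\mathcal O_y\times B_{\nu_0}$. Let $X=y(t)$, $Y=y(T)$. Then: 1. There is no Lavrentiev gap at $y$ for the problem with the initial condition, i.e. there exist Lipschitz functions $y_h:I\to\mathbb R^n$ with $y_h(t)=X$ for all $h$, $\limsup_{h\to\infty}F(y_h)=F(y)$, and $y_h\to y$ in $W^{1,p}(I;\mathbb R^n)$. 2. If moreover there is a nonempty subset $U_y\subseteq y(I)$, open relative to $y(I)$, such that for every $r>0$ the function $\Lambda$ is bounded on $I\times U_y\times B_r$, then there is no Lavrentiev gap at $y$ for the problem with both end point conditions, i.e. there exist Lipschitz functions $y_h:I\to\mathbb R^n$ with $y_h(t)=X$, $y_h(T)=Y$ for all $h$, $\limsup_{h\to\infty}F(y_h)=F(y)$, and $y_h\to y$ in $W^{1,p}(I;\mathbb R^n)$.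
   Context: $B_r$ denotes the closed ball of radius $r$ centred at the origin of $\mathbb R^n$; $|\cdot|$ is the Euclidean norm. $W^{1,p}(I;\mathbb R^n)$ is the Sobolev space of functions $y$ with $y,y'\in L^p(I;\mathbb R^n)$ (identified with their absolutely continuous representatives). *)

(* Defs.v *)
From HB Require Import structures.
From mathcomp Require Import all_boot all_order all_algebra.
From mathcomp Require Import all_classical all_reals all_analysis measurable_realfun.
Set Implicit Arguments. Unset Strict Implicit. Unset Printing Implicit Defensive.
Import Order.TTheory GRing.Theory Num.Theory.
Import numFieldNormedType.Exports.
Local Open Scope classical_set_scope.
Local Open Scope ring_scope.

Section Defs.
Variable R : realType.

Definition enorm (n : nat) (v : 'rV[R]_n) : R :=
  Num.sqrt (\sum_(i < n) (v ord0 i) ^+ 2).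

Definition borel_set (T : topologicalType) (A : set T) : Prop :=
  <<s [set U : set T | open U] >> A.

Definition borel_fun_on (T : topologicalType) (D : set T) (f : T -> \bar R) : Prop :=
  forall B : set (\bar R), measurable B -> borel_set (D `&` f @^-1` B).

(* dy is (a representative of) the weak derivative of y on [t,T], y in W^{1,p}:
   components of dy are measurable and p-integrable on [t,T], and y is the
   (absolutely continuous) primitive of dy. *)
Definition W1p (n : nat) (t T p : R) (y dy : R -> 'rV[R]_n) : Prop :=
  (forall i : 'I_n,
      measurable_fun `[t, T] (fun s => dy s ord0 i) /\
      (\int[lebesgue_measure]_(s in `[t, T]) ((`|dy s ord0 i| `^ p)%:E) < +oo)%E) /\
  (forall s, t <= s <= T ->
     forall i : 'I_n,
       y s ord0 i = y t ord0 i + \int[lebesgue_measure]_(x in `[t, s]) (dy x ord0 i)).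

Definition Ffun (n : nat) (t T : R) (Lam : R -> 'rV[R]_n -> 'rV[R]_n -> \bar R)
  (Psi : R -> 'rV[R]_n -> \bar R) (y dy : R -> 'rV[R]_n) : \bar R :=
  (\int[lebesgue_measure]_(s in `[t, T]) (Lam s (y s) (dy s) * Psi s (y s)))%E.

(* p-th power of the W^{1,p} distance (up to norm equivalence) *)
Definition W1p_dist (n : nat) (t T p : R) (y dy z dz : R -> 'rV[R]_n) : \bar R :=
  (\int[lebesgue_measure]_(s in `[t, T]) ((enorm (y s - z s) `^ p)%:E) +
   \int[lebesgue_measure]_(s in `[t, T]) ((enorm (dy s - dz s) `^ p)%:E))%E.

Definition lipschitz_on (n : nat) (t T : R) (f : R -> 'rV[R]_n) : Prop :=
  exists L : R, forall s1 s2, t <= s1 <= T -> t <= s2 <= T ->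
    enorm (f s1 - f s2) <= L * `|s1 - s2|.

Definition condS (n : nat) (t T p : R) (Lam : R -> 'rV[R]_n -> 'rV[R]_n -> \bar R) : Prop :=
  forall K : R, 0 <= K ->
  exists (kappa beta : R) (gamma : R -> R) (eps : R),
    0 <= kappa /\ 0 <= beta /\
    lebesgue_measure.-integrable `[t, T] (EFin \o gamma) /\ 0 < eps /\
    {ae lebesgue_measure, forall s, t <= s <= T ->
       forall s1 s2 z v,
         s - eps <= s1 <= s + eps -> t <= s1 <= T ->
         s - eps <= s2 <= s + eps -> t <= s2 <= T ->
         enorm z <= K -> (Lam s z v < +oo)%E ->
         (`|Lam s2 z v - Lam s1 z v| <=
            (kappa%:E * Lam s z v + (beta * enorm v `^ p + gamma s)%:E)
              * (`|s2 - s1|)%:E)%E}.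

Definition no_gap (both : bool) (n : nat) (t T p : R)
  (Lam : R -> 'rV[R]_n -> 'rV[R]_n -> \bar R) (Psi : R -> 'rV[R]_n -> \bar R)
  (y dy : R -> 'rV[R]_n) : Prop :=
  exists yh dyh : nat -> R -> 'rV[R]_n,
    (forall h, lipschitz_on t T (yh h)) /\
    (forall h, W1p t T p (yh h) (dyh h)) /\
    (forall h, yh h t = y t) /\
    (both -> forall h, yh h T = y T) /\
    limn_esup (fun h => Ffun t T Lam Psi (yh h) (dyh h)) = Ffun t T Lam Psi y dy /\
    ((fun h => W1p_dist t T p (yh h) (dyh h) y dy) @ \oo --> 0%E).

End Defs.

(* Main.v *)
(** Fix a Lipschitz threshold: where |y'| is huge, slow the clock down.  Let
phi be the time change with phi' = |y'|/nu0 where |y'| > N, phi' slightly below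
1 (at least 1/2) on a small set where y stays in U and y' is bounded, and
phi' = 1 elsewhere; the competitor is y_N = y o phi^-1.  Its speed is
|y'|/phi' o phi^-1, which is at most nu0 on the spikes of y', so y_N is
Lipschitz and the spikes cost at most (sup Lambda)(sup Psi) times the integral
of |y'|/nu0 over {|y'| > N}, which tends to 0.  Elsewhere Lambda and Psi are
only shifted in time by |phi(s) - s| -> 0, which Condition (S) and the
continuity of Psi(., z) absorb by dominated convergence.  The clock gains time
on the spikes: with only the initial condition one truncates at T, and with
both end points the small slow set gives the time back.  Convergence of y_N'
in L^p follows by comparing y' with a bounded continuous function. *)
Require Import Defs.
From HB Require Import structures.
From mathcomp Require Import all_boot all_order all_algebra.
From mathcomp Require Import all_classical all_reals all_analysis measurable_realfun.
Import Order.TTheory GRing.Theory Num.Theory.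
Import numFieldNormedType.Exports.
Local Open Scope classical_set_scope.
Local Open Scope ring_scope.
From mathcomp Require Import lra ring.
Set Implicit Arguments.
Unset Strict Implicit.
Unset Printing Implicit Defensive.

(** * Measures with a density *)

(** [Lam] and [Psi] are merely Borel in the state, so a competitor cannot be compared with y at
    equal times. The comparison is made after pulling back by the clock: the energy of y o phi^-1
    equals the integral over [t, phi^-1(T)] of Lam(phi(s), y(s), y'(s)/phi'(s)) Psi(phi(s), y(s))
    phi'(s). The state is again y(s), and wherever phi' = 1 the velocity is again y'(s), so only the
    time argument has moved. On the perturbed set boundedness alone is used: nu0 is the radius of
    the ball in (iii), and since phi' >= 1/2 speeds at most double on the slow set, so a bound of
    Lam for velocities up to 2r is what the second statement must supply.

    With both end points the slow set S_k is fixed before the threshold N. The time gained on the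
    spikes tends to 0 as N grows, so N can be chosen with a gain of at most half the measure of S_k;
    the quotient theta <= 1/2 is the amount by which phi' falls below 1 on S_k, and phi(T) = T
    exactly. With only the initial condition S_k is empty and theta = 0, so one construction serves
    both statements. *)

Section density_measure.
Import HBNNSimple.
Context d (T : measurableType d) (R : realType) (m : {measure set T -> \bar R}).
Variables (rho : T -> R).
Hypotheses (mrho : measurable_fun setT rho) (rho0 : forall x, 0 <= rho x).

(** The two proofs are phantom arguments: they let the measure instance be
inferred from [mdensity]. *)
Definition mdensity (_ : measurable_fun setT rho) (_ : forall x, 0 <= rho x)
  (A : set T) : \bar R := (\int[m]_(x in A) (rho x)%:E)%E.

Let mrhoE D : measurable D -> measurable_fun D (EFin \o rho).
Proof. by move=> mD; exact/measurable_EFinP/measurable_funTS. Qed.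

Local Notation mdens := (mdensity mrho rho0).

Let mdensity0 : mdens set0 = 0%E.
Proof. exact: integral_set0. Qed.

Let mdensity_ge0 A : (0 <= mdens A)%E.
Proof. by apply: integral_ge0 => x _; rewrite lee_fin. Qed.

Let mdensity_sigma_additive : semi_sigma_additive mdens.
Proof.
move=> F mF tF mUF; rewrite /mdensity ge0_integral_bigcup//.
- by apply: is_cvg_nneseries => *; exact: mdensity_ge0.
- exact: mrhoE.
- by move=> x _; rewrite lee_fin.
Qed.

HB.instance Definition _ := isMeasure.Build _ _ _ mdens
  mdensity0 mdensity_ge0 mdensity_sigma_additive.

(** Both sides pass to the limit along increasing nonnegative simple functions. For a simple
    function both split over its values, and for an indicator the identity is the definition of
    [mdensity]. *)
Lemma integral_mdensity (D : set T) (f : T -> \bar R) :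
  measurable D -> measurable_fun D f -> (forall x, D x -> (0 <= f x)%E) ->
  (\int[mdens]_(x in D) f x = \int[m]_(x in D) (f x * (rho x)%:E))%E.
Proof.
move=> mD mf f0.
pose f_ := nnsfun_approx mD mf.
have mrhoD : measurable_fun D (EFin \o rho) by exact: mrhoE.
transitivity (limn (fun n => \int[mdens]_(x in D) (f_ n x)%:E))%E.
  rewrite -monotone_convergence//.
  - apply: eq_integral => x /[!inE] xD; apply/esym/cvg_lim => //.
    by apply: cvg_nnsfun_approx.
  - by move=> n; exact/measurable_EFinP/measurable_funP.
  - by move=> n x _; rewrite lee_fin.
  - by move=> x _ a b ab; rewrite lee_fin; exact/lefP/nd_nnsfun_approx.
transitivity (limn (fun n => \int[m]_(x in D) ((f_ n x)%:E * (rho x)%:E)))%E; last first.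
  rewrite -monotone_convergence//.
  - apply: eq_integral => x /[!inE] xD; apply/cvg_lim => //.
    apply: cvgeZr => //.
    by apply: cvg_nnsfun_approx.
  - move=> n; apply: emeasurable_funM => //.
    exact/measurable_EFinP/measurable_funP.
  - by move=> n x _; rewrite mule_ge0// lee_fin//.
  - move=> x _ a b ab; apply: lee_wpmul2r; rewrite lee_fin//.
    exact/lefP/nd_nnsfun_approx.
congr (limn _); apply/funext => n.
have pos r x : (0 <= (r * \1_(f_ n @^-1` [set r]) x)%:E)%E.
  by rewrite EFinM nnfun_muleindic_ge0.
under [LHS]eq_integral do rewrite fimfunE -fsumEFin//.
rewrite ge0_integral_fsum//; last first.
  by move=> r; exact/measurable_EFinP/measurable_funM.
under [RHS]eq_integral => x xD.
  rewrite fimfunE -fsumEFin// ge0_mule_fsuml; last first.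
    by move=> r; exact: pos.
  over.
rewrite ge0_integral_fsum//; last 2 first.
  - move=> r; apply: emeasurable_funM => //; exact/measurable_EFinP/measurable_funM.
  - by move=> r x _; apply: mule_ge0; rewrite ?pos// lee_fin.
apply: eq_fsbigr => r _.
rewrite integralZl_indic_nnsfun// integral_indic//.
(* A nonnegative simple function takes no negative value, so such a term is zero on both sides. *)
have [r0|r0] := leP 0 r; last first.
  rewrite preimage_nnfun0// set0I measure0 mule0 integral0_eq// => x _.
  by rewrite indicE in_set0 mulr0 mul0e.
under eq_integral do rewrite EFinM -muleA.
rewrite ge0_integralZl//; last 2 first.
  - apply: emeasurable_funM => //; exact/measurable_EFinP/measurable_funTS/measurable_indic.
  - by move=> x _; rewrite mule_ge0// lee_fin//.
congr (_ * _)%E; rewrite setIC.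
transitivity (\int[m]_(x in D `&` f_ n @^-1` [set r]) (rho x)%:E)%E => //.
rewrite integral_mkcondr.
apply: eq_integral => x xD.
by rewrite epatch_indic muleC.
Qed.

End density_measure.

(** * Time changes *)

Section real_integrable.
Context d (T : measurableType d) (R : realType) (m : {measure set T -> \bar R}).
Variables (D : set T) (mD : measurable D).
Implicit Types f g : T -> R.

Lemma integrableD_EFin f g : m.-integrable D (EFin \o f) ->
  m.-integrable D (EFin \o g) -> m.-integrable D (EFin \o (fun x => f x + g x)).
Proof. by move=> fi gi; exact: (integrableD mD fi gi). Qed.

Lemma integrableB_EFin f g : m.-integrable D (EFin \o f) ->
  m.-integrable D (EFin \o g) -> m.-integrable D (EFin \o (fun x => f x - g x)).
Proof. by move=> fi gi; exact: (integrableB mD fi gi). Qed.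

Lemma integrableZl_EFin c f : m.-integrable D (EFin \o f) ->
  m.-integrable D (EFin \o (fun x => c * f x)).
Proof. by move=> fi; exact: (integrableZl mD c fi). Qed.

Lemma le_integrable_EFin f g : measurable_fun D f ->
  (forall x, D x -> `|f x| <= g x) -> m.-integrable D (EFin \o g) ->
  m.-integrable D (EFin \o f).
Proof.
move=> mf fg ig; apply: le_integrable ig => //; first exact/measurable_EFinP.
move=> x Dx; rewrite /= lee_fin; apply: (le_trans (fg x Dx)).
exact: ler_norm.
Qed.

End real_integrable.

Lemma bounded_integrable d (T : measurableType d) (R : realType)
    (m : {measure set T -> \bar R}) (D : set T) (f : T -> R) (C : R) :
  measurable D -> (m D < +oo)%E -> measurable_fun D f ->
  (forall x, D x -> `|f x| <= C) -> m.-integrable D (EFin \o f).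
Proof.
move=> mD Dfin mf fC; apply: measurable_bounded_integrable => //.
exists C; split; first exact: num_real.
by move=> x Cx y Dy; apply: (le_trans (fC _ Dy)); exact: ltW.
Qed.

Lemma lebesgue_itv_lty (R : realType) (a b : R) (ba bb : bool) :
  (@lebesgue_measure R [set` Interval (BSide ba a) (BSide bb b)] < +oo)%E.
Proof. by rewrite lebesgue_measure_itv; case: ifP => //; rewrite -EFinB ltry. Qed.

Lemma bounded_integrable_itv (R : realType) (a b : R) (ba bb : bool)
    (f : R -> R) (C : R) (I := [set` Interval (BSide ba a) (BSide bb b)]) :
  measurable_fun I f -> (forall x, I x -> `|f x| <= C) ->
  lebesgue_measure.-integrable I (EFin \o f).
Proof.
move=> mf fC; apply: (bounded_integrable (C := C)) => //.
- exact: measurable_itv.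
- exact: lebesgue_itv_lty.
Qed.

Section time_change.
Context (R : realType) (e : R -> R).
Notation mu := (@lebesgue_measure R).
Hypotheses (me : measurable_fun setT e) (ie : mu.-integrable setT (EFin \o e))
  (e_ge : forall x, - 2^-1 <= e x).

(** The clock phi with phi' = 1 + e. It is defined on the whole line, so that it is a bijection of R
    and its inverse is total; the interval [t, T] enters only later, through the support of e. *)
Definition tchange (s : R) : R := s + \int[mu]_(x in `]-oo, s]) e x.

Let ieS A : measurable A -> mu.-integrable A (EFin \o e).
Proof. by move=> mA; apply: integrableS ie. Qed.

Lemma tchangeB a b : a <= b ->
  tchange b - tchange a = (b - a) + \int[mu]_(x in `]a, b]) e x.
Proof.
move=> ab; rewrite /tchange -(@Rintegral_itvB _ e -oo%O (BRight b) a)//.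
  by ring.
exact: ieS.
Qed.

Lemma tchange_ge a b : a <= b -> 2^-1 * (b - a) <= tchange b - tchange a.
Proof.
move=> ab; rewrite tchangeB//.
have : \int[mu]_(x in `]a, b]) (- 2^-1) <= \int[mu]_(x in `]a, b]) e x.
  apply: le_Rintegral => //; last exact: ieS.
  apply: (bounded_integrable_itv (C := 2^-1)) => // x _.
  by rewrite normrN ger0_norm.
rewrite [X in X <= _](_ : _ = - 2^-1 * fine (mu `]a, b]%classic)); last first.
  exact: Rintegral_cst.
rewrite lebesgue_measure_itv/= lte_fin.
case: ifPn => [_ /=|]; first by lra.
by rewrite -leNgt => ba /=; lra.
Qed.

Lemma tchange_dist s : `|tchange s - s| <= \int[mu]_x `|e x|.
Proof.
rewrite /tchange addrAC subrr add0r.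
apply: (le_trans (le_normr_Rintegral _ _)) => //; first exact: ieS.
have ine A : measurable A -> mu.-integrable A (EFin \o (fun x => `|e x|)).
  by move=> mA; apply: integrable_norm; exact: ieS.
apply: fine_le; [exact: integrable_fin_num (ine _ _)|exact: integrable_fin_num (ine _ _)|].
apply: ge0_subset_integral => //=.
exact: (measurable_int mu (ine _ _)).
Qed.

Lemma tchange_le : {mono tchange : a b / a <= b}.
Proof.
apply: le_mono => a b ab.
by have := tchange_ge (ltW ab); lra.
Qed.

(** The clock moves no point by more than C, the L^1 norm of e, so r lies between its values at r -
    C and r + C; the intermediate value theorem applies on that interval. *)
Lemma tchange_surj r : exists s, tchange s = r.
Proof.
pose C := \int[mu]_x `|e x|.
have C0 : 0 <= C by apply: Rintegral_ge0.
pose a := r - C; pose b := r + C.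
have ab : a <= b by rewrite /a /b; lra.
have ta := tchange_dist a; have tb := tchange_dist b.
rewrite -/C ler_norml in ta; rewrite -/C ler_norml in tb.
have [] := @IVT _ tchange a b r ab.
- pose g x := (tchange a - a) + x + parameterized_integral mu a x e.
  have cg : {within `[a, b], continuous g}.
    move=> x; apply: continuousD; last first.
      by apply: parameterized_integral_continuous => //; exact: ieS.
    apply: continuous_subspaceT => z.
    by apply: (@cvgD _ _ _ _ _ (cst _) id); [exact: cvg_cst|exact: cvg_id].
  have gE : {in `[a, b]%classic, g =1 tchange}.
    move=> x; rewrite inE/= in_itv/= => /andP[ax xb].
    have := tchangeB ax; rewrite Rintegral_itv_obnd_cbnd; last exact: ieS.
    by rewrite /g /parameterized_integral; lra.
  exact: subspace_eq_continuous gE cg.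
- rewrite ge_min le_max; apply/andP; split; apply/orP;
    [left|right]; rewrite /a /b in ta tb *; lra.
- by move=> c _ <-; exists c.
Qed.

Definition tchange_inv (r : R) : R := sval (cid (tchange_surj r)).

Lemma tchange_invK : cancel tchange_inv tchange.
Proof. by move=> r; rewrite /tchange_inv; case: cid. Qed.

Lemma tchangeK : cancel tchange tchange_inv.
Proof. exact: (inj_can_sym tchange_invK (inc_inj tchange_le)). Qed.

Lemma tchange_inv_le : {mono tchange_inv : a b / a <= b}.
Proof. by move=> a b; rewrite -tchange_le !tchange_invK. Qed.

Lemma tchange_leE x r : (tchange x <= r) = (x <= tchange_inv r).
Proof. by rewrite -[in RHS]tchange_le tchange_invK. Qed.

Lemma measurable_tchange : measurable_fun setT tchange.
Proof. by apply: nondecreasing_measurable => // a b; rewrite tchange_le. Qed.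

Lemma measurable_tchange_inv : measurable_fun setT tchange_inv.
Proof. by apply: nondecreasing_measurable => // a b; rewrite tchange_inv_le. Qed.

Let rho x := 1 + e x.

Let rho0 x : 0 <= rho x.
Proof. by have := e_ge x; rewrite /rho; lra. Qed.

Let mrho : measurable_fun setT rho.
Proof. exact: measurable_funD. Qed.

Local Notation mrhod := (mdensity mu mrho rho0).

(** Change of variables without differentiating phi: the image under phi of the measure with density
    phi' gives ]a, b] the mass phi(phi^-1(b)) - phi(phi^-1(a)) = b - a, and Lebesgue measure is the
    only measure with these values on half-open intervals. *)
Lemma lebesgue_measure_tchange (A : set R) : measurable A ->
  mu A = pushforward mrhod tchange A.
Proof.
move=> mA.
apply: (@lebesgue_measure_unique _
  (pushforward mrhod (tchange : _ -> measurableTypeR R)) _ A mA).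
  exact: measurable_tchange.
move=> mt _ [[a b]] _ <-.
rewrite [RHS](_ : _ = mrhod (tchange @^-1` `]a, b])); last exact: erefl.
have -> : tchange @^-1` `]a, b] = `]tchange_inv a, tchange_inv b]%classic.
  by apply/seteqP; split => x /=; rewrite !in_itv/= !ltNge !tchange_leE.
rewrite lebesgue_measure_itv/= lte_fin.
case: ifPn => [ab|]; last first.
  rewrite -leNgt => ba; rewrite set_itv_ge ?bnd_simp ?measure0//.
  by rewrite -leNgt tchange_inv_le.
pose I := `]tchange_inv a, tchange_inv b]%classic.
have mI : measurable (I : set (measurableTypeR R)) by exact: measurable_itv.
have i1 : mu.-integrable I (EFin \o cst 1).
  by apply: (bounded_integrable_itv (C := 1)) => // x _; rewrite normr1.
have iI : mu.-integrable I (EFin \o rho).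
  exact: (integrableD_EFin mI i1 (ieS mI)).
have ba : tchange_inv a <= tchange_inv b by rewrite tchange_inv_le ltW.
transitivity (\int[mu]_(x in I) rho x)%:E; last first.
  by rewrite /Rintegral fineK//; exact: integrable_fin_num iI.
congr EFin; rewrite RintegralD//; last exact: ieS mI.
have := tchangeB ba; rewrite !tchange_invK => ->; congr +%R.
rewrite [RHS](_ : _ = 1 * fine (mu `]tchange_inv a, tchange_inv b]%classic));
  last exact: Rintegral_cst.
rewrite lebesgue_measure_itv/= lte_fin mul1r.
case: ifPn => //; rewrite -leNgt => ab'.
by apply/eqP; rewrite subr_eq0 eq_le ab' ba.
Qed.

Lemma integral_tchange (D : set R) (f : R -> \bar R) :
  measurable D -> measurable_fun D f -> (forall x, D x -> (0 <= f x)%E) ->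
  (\int[mu]_(x in D) f x =
   \int[mu]_(x in tchange @^-1` D) (f (tchange x) * (1 + e x)%:E))%E.
Proof.
move=> mD mf f0.
transitivity
  (\int[pushforward mrhod (tchange : _ -> measurableTypeR R)]_(x in D) f x)%E.
  apply: eq_measure_integral => [|mt A mA _]; first exact: measurable_tchange.
  exact: lebesgue_measure_tchange.
rewrite ge0_integral_pushforward//; last first.
  by move=> x /[!inE]; exact: f0.
  exact: measurable_tchange.
have mpre : measurable (tchange @^-1` D : set (measurableTypeR R)).
  by rewrite -[_ @^-1` D]setTI; exact: measurable_tchange.
rewrite integral_mdensity//.
- apply: (measurable_comp mD) => //; first by move=> _ [x Dx <-].
  exact: measurable_funTS measurable_tchange.
- by move=> x /=; exact: f0.
Qed.
End time_change.

(** * Measurability of Borel functions of arcs *)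

Lemma ball_rowE (R : realType) (n : nat) (x z : 'rV[R]_n) (r : R) : 0 < r ->
  ball x r z <-> forall i, ball (x ord0 i) r (z ord0 i).
Proof.
move=> r0; split=> [[_ xz] i|xz]; first exact: xz.
by split=> // i j; rewrite (ord1 i); exact: xz.
Qed.

Section measurable_to_topological.
Context d (X : measurableType d) (R : realType).

(** Tested on open sets, to match [borel_fun_on], which refers to the sigma-algebra generated by the
    open sets of the product space. *)
Definition borel_measurable (T : topologicalType) (D : set X) (f : X -> T) :=
  forall U, open U -> measurable (D `&` f @^-1` U).

(** The sets whose preimage in D is measurable form a sigma-algebra containing the open sets, hence
    all Borel sets. *)
Lemma borel_measurable_comp (T : topologicalType) (D : set X) (S : set T)
    (f : X -> T) (g : T -> \bar R) :
  measurable D -> borel_fun_on S g -> borel_measurable D f ->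
  (forall x, D x -> S (f x)) -> measurable_fun D (g \o f).
Proof.
move=> mD mg mf DS _ B mB.
have sD : sigma_algebra D [set A | measurable A /\ A `<=` D].
  split=> /=; first by split=> //; exact: sub0set.
  - by move=> A [mA AD]; split; [exact: measurableD|by move=> x []].
  - move=> A AD; split; first by apply: bigcup_measurable => k _; case: (AD k).
    by move=> x [k _]; case: (AD k) => _; apply.
have : image_set_system D f [set A | measurable A /\ A `<=` D] (S `&` g @^-1` B).
  have := mg B mB; apply: smallest_sub; first exact: sigma_algebra_image.
  by move=> U oU /=; split; [exact: mf|by move=> x []].
case=> + _; congr measurable; apply/seteqP; split=> x [Dx /=].
  by case.
by move=> gB; split=> //; split=> //; exact: DS.
Qed.

(** By separability an open set is a countable union of balls with centres [q k] and radii 1/(m+1),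
    so preimages of these balls suffice. In a product space a ball is a product of balls, which
    reduces pairs and triples to their coordinates. *)
Lemma borel_measurable_dense (T : pseudoMetricType R) (K : countType)
    (q : K -> T) (D : set X) (f : X -> T) :
  (forall (x : T) (r : R), 0 < r -> exists k, ball (q k) r x) ->
  (forall k r, 0 < r -> measurable (D `&` f @^-1` (ball (q k) r))) ->
  borel_measurable D f.
Proof.
move=> qd mf U oU.
rewrite (_ : _ `&` _ = \bigcup_(km : K * nat)
   if `[< ball (q km.1) km.2.+1%:R^-1 `<=` U >]
   then D `&` f @^-1` (ball (q km.1) km.2.+1%:R^-1) else set0).
  apply: countable_bigcupT_measurable; first exact: countableP.
  by move=> km; case: ifP => // _; apply: mf; rewrite invr_gt0.
apply/seteqP; split=> x /=.
  case=> Dx Ufx.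
  have /nbhs_ballP[r /= r0 rU] : nbhs (f x) U by exact: open_nbhs_nbhs.
  (* A radius below r/2: a ball of this radius that contains f x lies in the r-ball around f x,
     hence in U. *)
  have [m] := ltr_add_invr (divr_gt0 r0 (ltr0n _ 2)).
  rewrite add0r => mr.
  have m0 : 0 < m.+1%:R^-1 :> R by rewrite invr_gt0.
  have [k kx] := qd (f x) m.+1%:R^-1 m0.
  exists (k, m) => //=; case: asboolP => [_|h]; first by [].
  exfalso; apply: h.
  move=> z kz; apply: rU.
  apply: (@le_ball _ _ _ (m.+1%:R^-1 + m.+1%:R^-1)).
    by rewrite [leRHS]splitr lerD// ltW.
  exact: ball_triangle (ball_sym kx) kz.
case=> -[k m] _ /=; case: asboolP => [kU|_]//.
by case=> Dx kx; split=> //; exact: kU.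
Qed.

End measurable_to_topological.

Lemma rat_ball_dense (R : realType) (x r : R) : 0 < r ->
  exists q : rat, ball (ratr q : R) r x.
Proof.
move=> r0; have [q] := @rat_in_itvoo R (x - r) (x + r) ltac:(lra).
rewrite in_itv/= => /andP[q1 q2]; exists q.
by rewrite -ball_normE/= ltr_norml; apply/andP; split; lra.
Qed.

Lemma rat_ball_row_dense (R : realType) n (x : 'rV[R]_n) (r : R) : 0 < r ->
  exists q : 'rV[rat]_n, ball (map_mx ratr q : 'rV[R]_n) r x.
Proof.
move=> r0.
have /choice[q qE] : forall i, exists q : rat, ball (ratr q : R) r (x ord0 i).
  by move=> i; exact: rat_ball_dense.
exists (\row_i q i); apply/ball_rowE => // i.
by rewrite !mxE.
Qed.

Section measurable_product.
Context d (X : measurableType d) (R : realType) (n : nat) (D : set X).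
Hypothesis mD : measurable D.

Lemma measurable_ball_preimage (f : X -> R) (q r : R) : measurable_fun D f ->
  measurable (D `&` f @^-1` (ball q r)).
Proof.
move=> mf; apply: mf => //.
by rewrite -ball_normE; exact: (open_measurable (ball_open _ _)).
Qed.

Lemma measurable_row_ball_preimage (f : X -> 'rV[R]_n) (q : 'rV[R]_n) (r : R) :
  0 < r -> (forall i, measurable_fun D (fun s => f s ord0 i)) ->
  measurable (D `&` f @^-1` (ball q r)).
Proof.
move=> r0 mf.
rewrite (_ : _ `&` _ = D `&` \bigcap_(i in [set: 'I_n])
    (D `&` (fun s => f s ord0 i) @^-1` (ball (q ord0 i) r))).
  apply: measurableI => //; apply: fin_bigcap_measurable => // i _.
  exact: measurable_ball_preimage.
apply/seteqP; split=> s /= [Ds]; 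
  first by move=> /ball_rowE qf; split=> // i _; split=> //; exact: qf.
by move=> qf; split=> //; apply/ball_rowE => // i; have [] := qf i I.
Qed.

Lemma borel_measurable_pair (a : X -> R) (b : X -> 'rV[R]_n) :
  measurable_fun D a -> (forall i, measurable_fun D (fun s => b s ord0 i)) ->
  @borel_measurable _ X (R * 'rV[R]_n)%type D (fun s => (a s, b s)).
Proof.
move=> ma mb; apply: (@borel_measurable_dense _ _ R (R * 'rV[R]_n)%type _
  (fun q : rat * 'rV[rat]_n => (ratr q.1 : R, map_mx ratr q.2 : 'rV[R]_n))).
  move=> x r r0; have [q1 h1] := rat_ball_dense x.1 r0.
  by have [q2 h2] := rat_ball_row_dense x.2 r0; exists (q1, q2).
move=> k r r0.
rewrite (_ : _ `&` _ = (D `&` a @^-1` (ball (ratr k.1 : R) r)) `&`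
   (D `&` b @^-1` (ball (map_mx ratr k.2 : 'rV[R]_n) r))).
  apply: measurableI; first exact: measurable_ball_preimage.
  exact: measurable_row_ball_preimage.
by apply/seteqP; split=> s /= [] => [? []|[? ?] []].
Qed.

Lemma borel_measurable_triple (a : X -> R) (b c : X -> 'rV[R]_n) :
  measurable_fun D a -> (forall i, measurable_fun D (fun s => b s ord0 i)) ->
  (forall i, measurable_fun D (fun s => c s ord0 i)) ->
  @borel_measurable _ X (R * 'rV[R]_n * 'rV[R]_n)%type D
    (fun s => (a s, b s, c s)).
Proof.
move=> ma mb mc; apply: (@borel_measurable_dense _ _ R (R * 'rV[R]_n * 'rV[R]_n)%type _
  (fun q : rat * 'rV[rat]_n * 'rV[rat]_n =>
    (ratr q.1.1 : R, map_mx ratr q.1.2 : 'rV[R]_n, map_mx ratr q.2 : 'rV[R]_n))).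
  move=> x r r0; have [q1 h1] := rat_ball_dense x.1.1 r0.
  have [q2 h2] := rat_ball_row_dense x.1.2 r0.
  by have [q3 h3] := rat_ball_row_dense x.2 r0; exists (q1, q2, q3).
move=> k r r0.
rewrite (_ : _ `&` _ = (D `&` a @^-1` (ball (ratr k.1.1 : R) r)) `&`
   (D `&` b @^-1` (ball (map_mx ratr k.1.2 : 'rV[R]_n) r)) `&`
   (D `&` c @^-1` (ball (map_mx ratr k.2 : 'rV[R]_n) r))).
  apply: measurableI; last exact: measurable_row_ball_preimage.
  apply: measurableI; first exact: measurable_ball_preimage.
  exact: measurable_row_ball_preimage.
by apply/seteqP; split=> s /= [] => [? [[]]|[[? ?] []] ? ? []].
Qed.

End measurable_product.

(** * Euclidean norms and powers *)

Section euclidean_norm.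
Context (R : realType).
Implicit Types n : nat.

Lemma enorm_ge0 n (v : 'rV[R]_n) : 0 <= enorm v.
Proof. exact: sqrtr_ge0. Qed.

Lemma coord_le_enorm n (v : 'rV[R]_n) i : `|v ord0 i| <= enorm v.
Proof.
rewrite -sqrtr_sqr; apply: ler_wsqrtr.
rewrite (bigD1 i)//= lerDl; apply: sumr_ge0 => j _; exact: sqr_ge0.
Qed.

Lemma enorm_le_sum n (v : 'rV[R]_n) : enorm v <= \sum_i `|v ord0 i|.
Proof.
have s0 : 0 <= \sum_i `|v ord0 i| by exact: sumr_ge0.
rewrite -[leRHS]ger0_norm// -sqrtr_sqr; apply: ler_wsqrtr.
rewrite expr2 mulr_suml; apply: ler_sum => i _.
rewrite -real_normK ?num_real// expr2 ler_wpM2l//.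
by rewrite (bigD1 i)//= lerDl; exact: sumr_ge0.
Qed.

Lemma enormZ n c (v : 'rV[R]_n) : enorm (c *: v) = `|c| * enorm v.
Proof.
rewrite /enorm -sqrtr_sqr -sqrtrM ?sqr_ge0// mulr_sumr; congr Num.sqrt.
by apply: eq_bigr => i _; rewrite mxE exprMn.
Qed.

Lemma measurable_enorm d (X : measurableType d) (D : set X) n
    (f : X -> 'rV[R]_n) :
  (forall i, measurable_fun D (fun s => f s ord0 i)) ->
  measurable_fun D (fun s => enorm (f s)).
Proof.
move=> mf; apply: (measurableT_comp (f := @Num.sqrt R)).
  by apply: continuous_measurable_fun; exact: sqrt_continuous.
by apply: measurable_sum => i; exact: measurable_funX.
Qed.

(** The sum is at most n times its largest term, and the p-th power of that term is one of the
    summands on the right. *)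
Lemma powR_sum_le n (p : R) (a : 'I_n -> R) : (0 < n)%N -> 0 <= p ->
  (forall i, 0 <= a i) ->
  (\sum_i a i) `^ p <= n%:R `^ p * \sum_i a i `^ p.
Proof.
case: n a => // n a _ p0 a0.
have [i _ ai] := @arg_maxP _ _ 'I_n.+1 ord0 xpredT a erefl.
have : \sum_j a j <= n.+1%:R * a i.
  rewrite mulr_natl -[in leRHS](card_ord n.+1) -sumr_const.
  by apply: ler_sum => j _; exact: ai.
move=> /(ge0_ler_powR p0); rewrite !nnegrE sumr_ge0// mulr_ge0// => /(_ erefl erefl).
move=> /le_trans; apply; rewrite powRM// ler_wpM2l ?powR_ge0//.
by rewrite (bigD1 i)//= lerDl; apply: sumr_ge0 => j _; exact: powR_ge0.
Qed.

Lemma enorm_powR_le n (p : R) (v : 'rV[R]_n) : (0 < n)%N -> 0 <= p ->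
  enorm v `^ p <= n%:R `^ p * \sum_i `|v ord0 i| `^ p.
Proof.
move=> n0 p0; apply: le_trans (powR_sum_le n0 p0 _) => //.
apply: ge0_ler_powR => //; rewrite ?nnegrE ?enorm_ge0//; first exact: sumr_ge0.
exact: enorm_le_sum.
Qed.

Lemma powR_add2_le (p x y : R) : 0 <= p ->
  `|x + y| `^ p <= 2 `^ p * (`|x| `^ p + `|y| `^ p).
Proof.
move=> p0; have := @powR_sum_le 2 p (fun i => if i == ord0 then `|x| else `|y|).
rewrite !big_ord_recl !big_ord0 /= !addr0 => H.
apply: le_trans (H _ p0 _) => //; last by move=> i; case: ifP.
by apply: ge0_ler_powR => //; rewrite ?nnegrE ?addr_ge0// ler_normD.
Qed.

Lemma cvg_powR0 (p : R) (u : nat -> R) : 1 <= p -> (forall k, 0 <= u k) ->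
  u k @[k --> \oo] --> 0 -> u k `^ p @[k --> \oo] --> 0.
Proof.
move=> p1 u0 cu.
apply: (squeeze_cvgr _ (cvg_cst 0) cu).
(* Below 1 the power p >= 1 only decreases a number, so u k itself is the upper bound of the
   squeeze. *)
have : \forall k \near \oo, u k < 1.
  by apply: (cvgr_lt 0).
apply: filterS => k uk; rewrite powR_ge0/=.
have [->|uk0] := eqVneq (u k) 0; first by rewrite powR0// gt_eqF//; lra.
have {}uk0 : 0 < u k by rewrite lt_neqAle eq_sym uk0 u0.
have a01 : 0 < u k <= 1 by rewrite uk0 ltW.
by rewrite -[leRHS](powRr1 (u0 k)); exact: (ger_powR a01).
Qed.

End euclidean_norm.

(** * Dominated convergence for real-valued functions *)

Section dominated_convergence_real.
Context d (T : measurableType d) (R : realType) (m : {measure set T -> \bar R}).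
Variables (D : set T) (f_ : nat -> T -> R) (f g : T -> R).
Hypotheses (mD : measurable D) (mf_ : forall k, measurable_fun D (f_ k))
  (ig : m.-integrable D (EFin \o g)).

Lemma ae_dominated_convergence_EFin : measurable_fun D f ->
  {ae m, forall x, D x -> f_ k x @[k --> \oo] --> f x} ->
  {ae m, forall x, D x -> forall k, `|f_ k x| <= g x} ->
  (\int[m]_(x in D) (f_ k x)%:E @[k --> \oo] --> \int[m]_(x in D) (f x)%:E)%E.
Proof.
move=> mf ff fg.
have [] // := @dominated_convergence _ _ _ m D mD (fun k x => (f_ k x)%:E)
  (fun x => (f x)%:E) (EFin \o g).
- by move=> k; exact/measurable_EFinP.
- exact/measurable_EFinP.
- by apply: filterS ff => x h Dx; apply/cvg_EFin; [exact: nearW|exact: h].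
- by apply: filterS fg => x h k Dx; rewrite /= lee_fin; exact: h.
Qed.

Lemma dominated_convergence_EFin :
  (forall x, D x -> f_ k x @[k --> \oo] --> f x) ->
  (forall x, D x -> forall k, `|f_ k x| <= g x) ->
  (\int[m]_(x in D) (f_ k x)%:E @[k --> \oo] --> \int[m]_(x in D) (f x)%:E)%E.
Proof.
move=> ff fg; apply: ae_dominated_convergence_EFin; [|exact: aeW|exact: aeW].
apply: (@measurable_fun_cvg _ _ _ D f_) => //.
Qed.

End dominated_convergence_real.

Lemma le_integral_add (d : measure_display) (T : measurableType d)
    (R : realType) (m : {measure set T -> \bar R}) (D : set T)
    (h a b : T -> R) (c w : R) : measurable D ->
  measurable_fun D h -> measurable_fun D a -> measurable_fun D b ->
  (forall x, 0 <= h x) -> (forall x, 0 <= a x) -> (forall x, 0 <= b x) ->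
  0 <= c -> 0 <= w -> (forall x, D x -> h x <= c * (a x + w * b x)) ->
  (\int[m]_(x in D) (h x)%:E <=
   c%:E * (\int[m]_(x in D) (a x)%:E + w%:E * \int[m]_(x in D) (b x)%:E))%E.
Proof.
move=> mD mh ma mb h0 a0 b0 c0 w0 le.
have mwb : measurable_fun D (fun x => (w * b x)%:E).
  by apply/measurable_EFinP; exact: measurable_funM.
have mab : measurable_fun D (fun x => (a x + w * b x)%:E).
  by apply/measurable_EFinP; apply: measurable_funD => //; exact/measurable_EFinP.
apply: (@le_trans _ _ (\int[m]_(x in D) (c%:E * (a x + w * b x)%:E))%E).
  apply: ge0_le_integral => //.
  - by move=> x _; rewrite lee_fin.
  - exact/measurable_EFinP.
  - exact: measurable_funeM.
have a0E x : (0 <= (a x)%:E)%E by rewrite lee_fin.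
have b0E x : (0 <= (b x)%:E)%E by rewrite lee_fin.
have wb0E x : (0 <= (w * b x)%:E)%E by rewrite lee_fin mulr_ge0.
have maE : measurable_fun D (EFin \o a) by exact/measurable_EFinP.
have mbE : measurable_fun D (EFin \o b) by exact/measurable_EFinP.
rewrite ge0_integralZl//; last by move=> x _; rewrite EFinD adde_ge0.
under eq_integral do rewrite EFinD.
rewrite ge0_integralD//.
under [X in (_ * (_ + X))%E]eq_integral do rewrite EFinM.
by rewrite ge0_integralZl.
Qed.

(** * Density of bounded continuous functions in L^p *)

Lemma cvge0P (R : realType) (u : nat -> \bar R) : (forall k, (0 <= u k)%E) ->
  u k @[k --> \oo] --> 0%E <->
  (forall e : R, 0 < e -> \forall k \near \oo, (u k <= e%:E)%E).
Proof.
move=> u0; split=> [/fine_cvgP[ufin /cvgr0Pnorm_le uf] e e0|H].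
  near=> k; rewrite -[u k]fineK; last by near: k.
  rewrite lee_fin; apply: (le_trans (ler_norm _)).
  by near: k; exact: uf.
apply/fine_cvgP; split.
  near=> k; rewrite ge0_fin_numE//; apply: (@le_lt_trans _ _ 1%:E); rewrite ?ltry//.
  by near: k; exact: H.
apply/cvgr0Pnorm_le => e e0; near=> k.
rewrite ger0_norm ?fine_ge0//=.
have uk : (u k <= e%:E)%E by near: k; exact: H.
by have := fine_le _ _ uk; apply => //; rewrite ge0_fin_numE// (le_lt_trans uk)// ltry.
Unshelve. all: by end_near.
Qed.

Lemma measurable_powR_norm d (X : measurableType d) (R : realType) (D : set X)
    (p : R) (g : X -> R) : measurable_fun D g ->
  measurable_fun D (fun x => `|g x| `^ p).
Proof.
move=> mg; apply: (measurableT_comp (measurable_powR p)).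
exact: measurableT_comp.
Qed.

(** Projecting b onto [-K, K] does not move it away from a point a of that interval. *)
Lemma clip_dist (R : realDomainType) (K a b : R) : - K <= a -> a <= K ->
  `|a - Num.max (- K) (Num.min K b)| <= `|a - b|.
Proof.
move=> Ka aK; rewrite ler_norml; apply/andP.
have [K1|K1] := leP K b; [have [K2|K2] := leP (- K) K|have [K2|K2] := leP (- K) b];
  by split; have [?|?] := ler0P (a - b); lra.
Qed.

Section Lp_density.
Context (R : realType) (D : set R) (f : R -> R) (p : R).
Notation mu := (@lebesgue_measure R).
Hypotheses (mD : measurable (D : set (measurableTypeR R))) (Dfin : (mu D < +oo)%E)
  (p1 : 1 <= p) (mf : measurable_fun D f)
  (fp : (\int[mu]_(x in D) (`|f x| `^ p)%:E < +oo)%E).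

Let p0 : 0 <= p. Proof. by move: p1; lra. Qed.

Lemma integrable_powR_norm : mu.-integrable D (EFin \o (fun x => `|f x| `^ p)).
Proof.
apply/integrableP; split.
  exact/measurable_EFinP/measurable_powR_norm.
by under eq_integral do rewrite /= ger0_norm ?powR_ge0//.
Qed.

Let trunc (k : nat) (x : R) := if `|f x| <= k%:R then f x else 0.

Let mtrunc k : measurable_fun D (trunc k).
Proof.
apply: measurable_fun_if => //.
- by apply: measurable_fun_ler => //; exact: measurableT_comp.
- by apply: measurable_funS mf => // x [].
Qed.

Let trunc_cvg : (\int[mu]_(x in D) (`|f x - trunc k x| `^ p)%:E @[k --> \oo] --> 0)%E.
Proof.
have <- : (\int[mu]_(x in D) (0%R)%:E = 0)%E by exact: integral0.
apply: (dominated_convergence_EFin _ _ integrable_powR_norm) => //.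
- by move=> k; apply: measurable_powR_norm; apply: measurable_funB; [exact: mf|exact: mtrunc].
- move=> x Dx; apply: cvg_near_cst.
  have := @nbhs_infty_ger R `|f x|; apply: filterS => k fk.
  by rewrite /trunc fk subrr normr0 powR0// gt_eqF//; move: p1; lra.
- move=> x Dx k; rewrite ger0_norm ?powR_ge0// /trunc; case: ifP => _.
    by rewrite subrr normr0 powR0 ?powR_ge0// gt_eqF//; move: p1; lra.
  by rewrite subr0.
Qed.

(** Truncating f at height k costs little in L^p. The truncation is close in L^1 to a continuous h;
    clipping h to [-k, k] keeps it as close and bounds the difference, so that L^1 closeness becomes
    L^p closeness at the price of a factor depending only on k and p. *)
Lemma Lp_bounded_continuous_dense (eps : R) : 0 < eps ->
  exists (g : R -> R) (M : R), [/\ continuous g, forall x, `|g x| <= M &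
    (\int[mu]_(x in D) (`|f x - g x| `^ p)%:E <= eps%:E)%E].
Proof.
move=> eps0.
pose c : R := 2 `^ p.
have c0 : 0 < c by exact: powR_gt0.
pose e1 := eps / 2 / c.
have e10 : 0 < e1 by rewrite !divr_gt0.
have /cvge0P := trunc_cvg; case/(_ _)/(_ e1 e10).
  by move=> k; apply: integral_ge0 => x _; rewrite lee_fin powR_ge0.
move=> k _ /(_ k (leqnn k)) Hk.
(* w bounds the difference of two functions with values in [-k, k]; the extra 1 keeps it positive
   for k = 0, since e2 divides by a power of w. *)
pose w : R := k%:R *+ 2 + 1.
have w0 : 0 < w by rewrite /w mulr2n; have := ler0n R k; lra.
have itr : mu.-integrable D (EFin \o trunc k).
  apply: (bounded_integrable (C := k%:R)) => //; first exact: mtrunc.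
  move=> x _.
  by rewrite /trunc; case: ifP => // _; rewrite normr0.
have [h [ch ih]] := approximation_continuous_integrable mD Dfin itr.
(* Chosen so that c (e1 + w^(p-1) e2) = 2 c e1 = eps. *)
pose e2 := e1 / w `^ (p - 1).
have e20 : 0 < e2 by rewrite divr_gt0// powR_gt0.
move=> /cvge0P; case/(_ _)/(_ e2 e20).
  by move=> j; exact: integral_ge0.
move=> j _ /(_ j (leqnn j)) Hj.
pose g x : R := Num.max (- k%:R) (Num.min k%:R (h j x)).
have gk x : `|g x| <= k%:R.
  by rewrite ler_norml /g le_max lexx/= ge_max ge_min lexx/= andbT; have := ler0n R k; lra.
have cg : continuous g.
  move=> x; apply: (@continuous_max _ _ (cst (- k%:R)) (fun x => Num.min k%:R (h j x))).
    exact: cst_continuous.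
  apply: (@continuous_min _ _ (cst k%:R) (h j)); [exact: cst_continuous|exact: ch].
exists g, k%:R; split=> //.
have tk x : `|trunc k x| <= k%:R.
  by rewrite /trunc; case: ifP => // _; rewrite normr0.
have clip x : `|trunc k x - g x| <= `|trunc k x - h j x|.
  by have := tk x; rewrite ler_norml => /andP[t1 t2]; exact: clip_dist.
have trg x : `|trunc k x - g x| `^ p <= w `^ (p - 1) * `|trunc k x - h j x|.
  rewrite -mulr_powRB1//; last by move: p1; lra.
  rewrite mulrC ler_pM ?powR_ge0//.
  apply: ge0_ler_powR; rewrite ?nnegrE ?(ltW w0)//; first by move: p1; lra.
  by apply: (le_trans (ler_normB _ _)); have := tk x; have := gk x; rewrite /w mulr2n; lra.
have le x : `|f x - g x| `^ p <=
    c * (`|f x - trunc k x| `^ p + w `^ (p - 1) * `|trunc k x - h j x|).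
  rewrite (_ : f x - g x = (f x - trunc k x) + (trunc k x - g x)); last by ring.
  apply: (le_trans (powR_add2_le _ _ p0)); rewrite ler_pM2l// lerD2l; exact: trg.
pose A x := `|f x - trunc k x| `^ p.
pose B x := `|trunc k x - h j x|.
have mH : measurable_fun D (fun x => `|f x - g x| `^ p).
  apply: measurable_powR_norm; apply: measurable_funB; first exact: mf.
  by apply: measurable_funTS; exact: continuous_measurable_fun.
have mA : measurable_fun D A.
  by apply: measurable_powR_norm; apply: measurable_funB; [exact: mf|exact: mtrunc].
have mB : measurable_fun D B.
  apply: measurableT_comp => //; apply: measurable_funB; first exact: mtrunc.
  by apply: measurable_funTS; apply: continuous_measurable_fun; exact: ch.
have H0 x : 0 <= `|f x - g x| `^ p by exact: powR_ge0.
have A0 x : 0 <= A x by exact: powR_ge0.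
have B0 x : 0 <= B x by exact: normr_ge0.
have W0 : 0 <= w `^ (p - 1) by exact: powR_ge0.
apply: (le_trans (le_integral_add mu mD mH mA mB H0 A0 B0 (ltW c0) W0
  (fun x _ => le x))).
have -> : eps%:E = (c%:E * (e1%:E + (w `^ (p - 1))%:E * e2%:E))%E.
  transitivity (c * (e1 + w `^ (p - 1) * e2))%:E => //; congr EFin.
  rewrite /e2 mulrCA divff ?gt_eqF ?powR_gt0// mulr1 /e1.
  by field; rewrite gt_eqF.
have {}Hk : (\int[mu]_(x in D) (A x)%:E <= e1%:E)%E by exact: Hk.
have {}Hj : (\int[mu]_(x in D) (B x)%:E <= e2%:E)%E by exact: Hj.
by rewrite lee_pmul2l ?lte_fin ?fin_numE// leeD// lee_wpmul2l ?lee_fin.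
Qed.

End Lp_density.

Section time_change_interval.
Context (R : realType) (t T : R) (e : R -> R).
Notation mu := (@lebesgue_measure R).
Hypotheses (tT : t <= T) (me : measurable_fun setT e)
  (ie : mu.-integrable setT (EFin \o e)) (e_ge : forall x, - 2^-1 <= e x)
  (e_out : forall x, ~ (t <= x <= T) -> e x = 0) (e_mass : 0 <= \int[mu]_x e x).

Local Notation phi := (tchange e).
Local Notation psi := (tchange_inv ie).

Lemma tchange_left : phi t = t.
Proof.
rewrite /tchange -Rintegral_itv_bndo_bndc; last exact: integrableS ie.
rewrite [X in _ + X](_ : _ = 0) ?addr0//.
rewrite /Rintegral integral0_eq// => x /=; rewrite in_itv/= => xt.
by rewrite e_out//; apply/negP; rewrite negb_and -ltNge xt.
Qed.

Lemma tchange_right : phi T = T + \int[mu]_x e x.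
Proof.
rewrite /tchange; congr +%R; rewrite Rintegral_mkcond; congr Rintegral.
apply/funext => x; rewrite patchE; case: ifPn => //.
rewrite notin_setE/= in_itv/= => /negP; rewrite -ltNge => Tx.
by rewrite e_out//; apply/negP; rewrite negb_and -!ltNge Tx orbT.
Qed.

Lemma tchange_inv_left : psi t = t.
Proof. by rewrite -[in LHS]tchange_left; exact: tchangeK. Qed.

Lemma tchange_inv_right : \int[mu]_x e x = 0 -> psi T = T.
Proof.
move=> e0; have := tchange_right; rewrite e0 addr0 => {1}<-; exact: tchangeK.
Qed.

Lemma tchange_inv_itv x : t <= x <= T -> t <= psi x <= T.
Proof.
move=> /andP[tx xT]; apply/andP; split.
  by rewrite -[leLHS]tchange_inv_left tchange_inv_le.
rewrite -(tchange_le ie)// tchange_invK; apply: (le_trans xT).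
by rewrite tchange_right lerDl.
Qed.

Lemma tchange_preimage x : phi @^-1` `[t, x] = `[t, psi x]%classic.
Proof.
have tE s : (t <= phi s) = (t <= s) by rewrite -{1}tchange_left tchange_le.
by apply/seteqP; split=> s /=; rewrite !in_itv/= tE (tchange_leE ie).
Qed.

Lemma measurable_comp_tchange_inv (x : R) (f : R -> R) : x <= T ->
  measurable_fun `[t, T] f -> measurable_fun `[t, x] (f \o psi).
Proof.
move=> xT mf; apply: (measurable_comp _ _ mf) => //.
  move=> _ [s + <-] /=; rewrite !in_itv/= => /andP[ts sx].
  rewrite !bnd_simp in ts sx.
  by apply: tchange_inv_itv; rewrite ts (le_trans sx).
exact: measurable_funTS (measurable_tchange_inv _ _).
Qed.

(** [integral_tchange] asks for nonnegative integrands, so the positive and negative parts of f are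
    treated apart; the weight 1 + e, being nonnegative, passes through both. *)
Lemma integral_comp_tchange_inv (f : R -> R) (x : R) : t <= x <= T ->
  measurable_fun `[t, T] f ->
  (\int[mu]_(s in `[t, x]) (f (psi s))%:E =
   \int[mu]_(s in `[t, psi x]) (f s * (1 + e s))%:E)%E.
Proof.
move=> /andP[tx xT] mf.
have nng (h : R -> R) : measurable_fun `[t, T] h -> (forall s, 0 <= h s) ->
  (\int[mu]_(s in `[t, x]) (h (psi s))%:E =
   \int[mu]_(s in `[t, psi x]) (h s * (1 + e s))%:E)%E.
  move=> mh h0; rewrite (integral_tchange me ie)//.
  - by rewrite tchange_preimage; apply: eq_integral => s _; rewrite tchangeK.
  - by apply/measurable_EFinP; exact: measurable_comp_tchange_inv.
  - by move=> s _; rewrite lee_fin.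
have e1 s : 0 <= 1 + e s by have := e_ge s; lra.
have maxM (a b : R) : 0 <= b -> Num.max (a * b) 0 = Num.max a 0 * b.
  by move=> b0; rewrite maxr_pMl// mul0r.
rewrite integralE [RHS]integralE; congr (_ - _)%E.
- transitivity (\int[mu]_(s in `[t, x]) (Num.max (f (psi s)) 0)%:E)%E.
    by apply: eq_integral => s _; rewrite funeposE -EFin_max.
  rewrite (nng (fun s => Num.max (f s) 0)).
  + by apply: eq_integral => s _; rewrite funeposE -EFin_max maxM.
  + by apply: measurable_maxr => //.
  + by move=> s; rewrite le_max lexx orbT.
- transitivity (\int[mu]_(s in `[t, x]) (Num.max (- f (psi s)) 0)%:E)%E.
    by apply: eq_integral => s _; rewrite funenegE -EFinN -EFin_max.
  rewrite (nng (fun s => Num.max (- f s) 0)).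
  + by apply: eq_integral => s _; rewrite funenegE -EFinN -mulNr -EFin_max maxM.
  + by apply: measurable_maxr => //; exact: measurableT_comp.
  + by move=> s; rewrite le_max lexx orbT.
Qed.

Lemma tchange_inv_near x : `|psi x - x| <= \int[mu]_x `|e x|.
Proof. by have := tchange_dist ie (psi x); rewrite tchange_invK distrC. Qed.

End time_change_interval.

(** * Sequences of perturbed clocks *)

Lemma within_continuous_cvg (R : realType) (V : topologicalType) (a b : R)
    (g : R -> V) (u : nat -> R) (x : R) :
  {within `[a, b], continuous g} -> a <= x <= b -> u k @[k --> \oo] --> x ->
  (\forall k \near \oo, a <= u k <= b) -> g (u k) @[k --> \oo] --> g x.
Proof.
move=> /subspace_continuousP cg xI ux uI U gU.
have xI' : `[a, b]%classic x by rewrite /= in_itv.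
have H : \forall k \near \oo, (fun z => `[a, b]%classic z -> U (g z)) (u k).
  exact: (ux _ (cg _ xI' _ gU)).
by apply: filterS2 H uI => k h kI; apply: h; rewrite /= in_itv.
Qed.

(** The clock is phi with phi' = 1 + [pert]; [pert_mass] says phi T >= T, so
that phi^-1 maps [t, T] into itself. *)
Record perturbation (R : realType) (t T : R) := Perturbation {
  pert :> R -> R;
  pert_measurable : measurable_fun setT pert;
  pert_integrable : (@lebesgue_measure R).-integrable setT (EFin \o pert);
  pert_ge : forall x, - 2^-1 <= pert x;
  pert_out : forall x, ~ (t <= x <= T) -> pert x = 0;
  pert_mass : 0 <= \int[@lebesgue_measure R]_x pert x }.

Section perturbation_sequence.
Context (R : realType) (t T : R) (E : nat -> perturbation t T).
Notation mu := (@lebesgue_measure R).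
Hypotheses (tT : t <= T)
  (E_cvg : \int[mu]_x `|E k x| @[k --> \oo] --> 0)
  (E_eventually : forall x, \forall k \near \oo, E k x = 0).

Definition clock k := tchange (E k).
Definition clock_inv k := tchange_inv (pert_integrable (E k)).

Local Notation psi := clock_inv.

Lemma one_pert_gt0 k x : 0 < 1 + E k x.
Proof. by have := pert_ge (E k) x; lra. Qed.

Lemma clock_inv_itv k x : t <= x <= T -> t <= psi k x <= T.
Proof.
apply: tchange_inv_itv => //.
- exact: pert_ge.
- exact: pert_out.
- exact: pert_mass.
Qed.

Lemma clock_inv_cvg x : psi k x @[k --> \oo] --> x.
Proof.
apply/cvgrPdist_le => eps eps0.
move/cvgr0Pnorm_le : E_cvg => /(_ eps eps0); apply: filterS => k.
rewrite ger0_norm ?Rintegral_ge0// distrC; apply: le_trans.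
by apply: tchange_inv_near; exact: pert_ge.
Qed.

Lemma measurable_pert k (D : set R) : measurable_fun D (E k).
Proof. exact: measurable_funTS (pert_measurable (E k)). Qed.

Lemma integral_comp_clock_inv k (f : R -> R) (x : R) : t <= x <= T ->
  measurable_fun `[t, T] f ->
  (\int[mu]_(s in `[t, x]) (f (psi k s))%:E =
   \int[mu]_(s in `[t, psi k x]) (f s * (1 + E k s))%:E)%E.
Proof.
apply: integral_comp_tchange_inv => //.
- exact: pert_measurable.
- exact: pert_ge.
- exact: pert_out.
- exact: pert_mass.
Qed.

Lemma measurable_comp_clock_inv k (f : R -> R) :
  measurable_fun `[t, T] f -> measurable_fun `[t, T] (f \o psi k).
Proof.
apply: measurable_comp_tchange_inv => //.
- exact: pert_ge.
- exact: pert_out.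
- exact: pert_mass.
Qed.

Lemma measurable_slowed k (f : R -> R) : measurable_fun `[t, T] f ->
  measurable_fun `[t, T] (fun x => f x / (1 + E k x)).
Proof.
move=> mf; apply: measurable_funM => //.
rewrite (_ : (fun x => _) = (fun x => (1 + E k x) `^ (-1))); last first.
  by apply/funext => x; rewrite powR_inv1// ltW// one_pert_gt0.
apply: (measurableT_comp (measurable_powR (-1))).
by apply: measurable_funD => //; exact: measurable_pert.
Qed.

(** Pointwise convergence comes from continuity and psi_k(x) -> x, domination from the constant
    (2M)^p. It serves the coordinates of y as well as the continuous approximants of y'. *)
Lemma Lp_translate_cvg (g : R -> R) (p M : R) : 1 <= p ->
  {within `[t, T], continuous g} -> (forall x, t <= x <= T -> `|g x| <= M) ->
  (\int[mu]_(x in `[t, T]) (`|g (psi k x) - g x| `^ p)%:E @[k --> \oo] --> 0)%E.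
Proof.
move=> p1 cg gM.
have p0 : 0 <= p by lra.
have mg : measurable_fun `[t, T] g.
  by apply: subspace_continuous_measurable_fun => //; exact: measurable_itv.
have M0 : 0 <= M by apply: le_trans (gM t _); rewrite ?normr_ge0// lexx.
have <- : (\int[mu]_(x in `[t, T]) (0%R)%:E = 0)%E by exact: integral0.
have iG : mu.-integrable `[t, T] (EFin \o cst ((M + M) `^ p)).
  by apply: (bounded_integrable_itv (C := (M + M) `^ p)) => // x _;
    rewrite ger0_norm ?powR_ge0.
apply: (dominated_convergence_EFin _ _ iG) => //.
- move=> k; apply: measurable_powR_norm; apply: measurable_funB => //.
  exact: measurable_comp_clock_inv.
- move=> x; rewrite /= in_itv/= => xI; apply: cvg_powR0 => //.
  have gx : g (psi k x) - g x @[k --> \oo] --> 0.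
    rewrite -(subrr (g x)); apply: cvgB; last exact: cvg_cst.
    apply: (within_continuous_cvg cg) => //; first exact: clock_inv_cvg.
    by apply: nearW => k; exact: clock_inv_itv.
  exact/norm_cvg0P.
- move=> x; rewrite /= in_itv/= => xI k; rewrite ger0_norm ?powR_ge0//.
  apply: ge0_ler_powR; rewrite ?nnegrE ?addr_ge0//.
  by apply: (le_trans (ler_normB _ _)); rewrite lerD// gM// clock_inv_itv.
Qed.

Section Lp_convergence.
Variables (f : R -> R) (p C0 : R) (dom : R -> R).
Hypotheses (p1 : 1 <= p) (mf : measurable_fun `[t, T] f)
  (fp : (\int[mu]_(x in `[t, T]) (`|f x| `^ p)%:E < +oo)%E)
  (idom : mu.-integrable `[t, T] (EFin \o dom))
  (slow : forall k x, t <= x <= T -> E k x != 0 -> `|f x / (1 + E k x)| <= C0)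
  (fast : forall k x, t <= x <= T -> E k x != 0 -> 1 + E k x <= dom x).

Let p0 : 0 <= p. Proof. by move: p1; lra. Qed.

Let fk k x := f x / (1 + E k x).

Let mfk k : measurable_fun `[t, T] (fk k).
Proof. exact: measurable_slowed. Qed.

(** The distance from f_k to g, pulled back to the original clock and hence weighted by phi_k'. At
    each point the integrand is eventually |f - g|^p, since E_k vanishes there eventually. Where E_k
    does not vanish, [slow] bounds f_k by C0 and [fast] bounds the weight by the integrable
    [dom]. *)
Let approx_cvg (g : R -> R) (M : R) : continuous g -> (forall x, `|g x| <= M) ->
  (\int[mu]_(x in `[t, T]) (`|fk k x - g x| `^ p * (1 + E k x))%:E @[k --> \oo]
   --> \int[mu]_(x in `[t, T]) (`|f x - g x| `^ p)%:E)%E.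
Proof.
move=> cg gM.
have mg (D : set R) : measurable_fun D g.
  by apply: measurable_funTS; exact: continuous_measurable_fun.
have M0 : 0 <= M by apply: le_trans (gM 0).
pose G x := 2 `^ p * (`|f x| `^ p + M `^ p) + (C0 + M) `^ p * `|dom x|.
have iG : mu.-integrable `[t, T] (EFin \o G).
  apply: integrableD_EFin => //; apply: integrableZl_EFin => //.
    apply: integrableD_EFin => //; first exact: integrable_powR_norm.
    by apply: (bounded_integrable_itv (C := M `^ p)) => // x _; rewrite ger0_norm ?powR_ge0.
  exact: integrable_norm.
apply: (dominated_convergence_EFin _ _ iG) => //.
- move=> k; apply: measurable_funM; last by apply: measurable_funD => //; exact: measurable_pert.
  by apply: measurable_powR_norm; apply: measurable_funB; [exact: mfk|exact: mg].
- move=> x Dx; apply: cvg_near_cst.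
  by apply: filterS (E_eventually x) => k; rewrite /fk => ->; rewrite addr0 divr1 mulr1.
- move=> x; rewrite /= in_itv/= => xI k.
  rewrite ger0_norm; last by rewrite mulr_ge0 ?powR_ge0// ltW// one_pert_gt0.
  rewrite /G; have [Ex|Ex] := eqVneq (E k x) 0.
    rewrite /fk Ex addr0 divr1 mulr1 -[leLHS]addr0 lerD// ?mulr_ge0 ?powR_ge0//.
    apply: (le_trans (powR_add2_le _ _ p0)); rewrite ler_wpM2l ?powR_ge0// lerD2l.
    by rewrite normrN; apply: ge0_ler_powR.
  rewrite -[leLHS]add0r lerD ?mulr_ge0 ?addr_ge0 ?powR_ge0//.
  have := slow xI Ex; have := fast xI Ex => h1 h2.
  apply: ler_pM; rewrite ?powR_ge0//; first exact/ltW/one_pert_gt0.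
    apply: ge0_ler_powR; rewrite ?nnegrE//.
      by apply: addr_ge0 => //; apply: le_trans h2.
    by apply: (le_trans (ler_normB _ _)); rewrite lerD.
  by apply: (le_trans h1); exact: ler_norm.
Qed.

Lemma Lp_clock_cvg :
  (\int[mu]_(x in `[t, T]) (`|fk k (psi k x) - f x| `^ p)%:E @[k --> \oo] --> 0)%E.
Proof.
apply/cvge0P; first by move=> k; apply: integral_ge0 => x _; rewrite lee_fin powR_ge0.
move=> eta eta0.
pose c : R := 2 `^ p.
have c0 : 0 < c by exact: powR_gt0.
(* Solves c (2 eta1 + c (2 eta1)) = eta: two uses of the quasi-triangle inequality with constant c,
   each of its two groups costing at most 2 eta1. *)
pose eta1 := eta / (2 * c * (1 + c)).
(* Compare both sides with a bounded continuous g: |f_k o psi - f| <=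
   |f_k - g| o psi + |g o psi - g| + |g - f|. *)
have eta10 : 0 < eta1 by rewrite divr_gt0// !mulr_gt0// addr_gt0.
have itv_lty : (mu `[t, T] < +oo)%E by exact: lebesgue_itv_lty.
have [g [M [cg gM fg]]] :=
  @Lp_bounded_continuous_dense _ `[t, T] f p (measurable_itv _) itv_lty p1 mf fp _ eta10.
have mg (D : set R) : measurable_fun D g.
  by apply: measurable_funTS; exact: continuous_measurable_fun.
have ha : \forall k \near \oo,
    (\int[mu]_(x in `[t, T]) (`|fk k x - g x| `^ p * (1 + E k x))%:E <= (2 * eta1)%:E)%E.
  have [l lE] : exists l : R, l%:E = (\int[mu]_(x in `[t, T]) (`|f x - g x| `^ p)%:E)%E.
    exists (fine (\int[mu]_(x in `[t, T]) (`|f x - g x| `^ p)%:E)); rewrite fineK//.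
    rewrite ge0_fin_numE; first by rewrite (le_lt_trans fg)// ltry.
    by apply: integral_ge0 => x _; rewrite lee_fin powR_ge0.
  have := approx_cvg cg gM; rewrite -lE => cvl.
  (* The limit is at most eta1; the factor 2 leaves the strict room needed for a bound at all large
     k. *)
  have ll : l < 2 * eta1.
    by move: fg; rewrite -lE lee_fin => h; apply: (le_lt_trans h); move: eta10; lra.
  have : \forall k \near \oo,
    (\int[mu]_(x in `[t, T]) (`|fk k x - g x| `^ p * (1 + E k x))%:E < (2 * eta1)%:E)%E.
    exact: (cvl _ (nbhs_open_ereal_lt (f := fun=> 2 * eta1) ll)).
  by apply: filterS => k; exact: ltW.
have /cvge0P tb := Lp_translate_cvg p1 (continuous_subspaceT cg) (fun x _ => gM x).
have /tb {}tb : forall k, (0 <= \int[mu]_(x in `[t, T]) (`|g (psi k x) - g x| `^ p)%:E)%E.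
  by move=> k; apply: integral_ge0 => x _; rewrite lee_fin powR_ge0.
have := tb _ eta10; apply: filterS2 ha => k ak bk.
pose A x := `|fk k (psi k x) - g (psi k x)| `^ p.
pose B x := `|g (psi k x) - g x| `^ p.
pose C x := `|g x - f x| `^ p.
have mA : measurable_fun `[t, T] A.
  apply: measurable_powR_norm; apply: measurable_funB.
    by apply: measurable_comp_clock_inv; exact: mfk.
  by apply: measurable_comp_clock_inv; exact: mg.
have mB : measurable_fun `[t, T] B.
  apply: measurable_powR_norm; apply: measurable_funB; last exact: mg.
  by apply: measurable_comp_clock_inv; exact: mg.
have mC : measurable_fun `[t, T] C.
  by apply: measurable_powR_norm; apply: measurable_funB => //; exact: mg.
have AE : (\int[mu]_(x in `[t, T]) (A x)%:E <= (2 * eta1)%:E)%E.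
  apply: le_trans ak.
  have tTT : t <= T <= T by rewrite tT lexx.
  have mAf : measurable_fun `[t, T] (fun x => `|fk k x - g x| `^ p).
    by apply: measurable_powR_norm; apply: measurable_funB; [exact: mfk|exact: mg].
  rewrite (integral_comp_clock_inv k tTT mAf).
  (* The change of variables ends at psi_k(T) <= T, and the integrand is nonnegative. *)
  apply: ge0_subset_integral => //.
  - apply/measurable_EFinP; apply: measurable_funM => //.
    by apply: measurable_funD => //; exact: measurable_pert.
  - by move=> x _; rewrite lee_fin mulr_ge0 ?powR_ge0// ltW// one_pert_gt0.
  - apply: subset_itvl; rewrite bnd_simp.
    by have /andP[] := clock_inv_itv k tTT.
have CE : (\int[mu]_(x in `[t, T]) (C x)%:E <= eta1%:E)%E.
  apply: le_trans fg; rewrite le_eqVlt; apply/orP; left; apply/eqP.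
  by apply: eq_integral => x _; rewrite /C distrC.
have BC : (\int[mu]_(x in `[t, T]) (B x + C x)%:E <= (2 * eta1)%:E)%E.
  apply: (@le_trans _ _ (1%:E * (\int[mu]_(x in `[t, T]) (B x)%:E +
                               1%:E * \int[mu]_(x in `[t, T]) (C x)%:E))%E).
    apply: le_integral_add => //.
    + exact: measurable_funD.
    + by move=> x; rewrite addr_ge0 ?powR_ge0.
    + by move=> x; rewrite powR_ge0.
    + by move=> x; rewrite powR_ge0.
    + by move=> x _; rewrite !mul1r.
  by rewrite !mul1e mulrDl mul1r EFinD leeD.
apply: (@le_trans _ _ (c%:E * (\int[mu]_(x in `[t, T]) (A x)%:E +
                         c%:E * \int[mu]_(x in `[t, T]) (B x + C x)%:E))%E).
  apply: le_integral_add => //.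
  - apply: measurable_powR_norm; apply: measurable_funB => //.
    by apply: measurable_comp_clock_inv; exact: mfk.
  - exact: measurable_funD.
  - by move=> x; rewrite /A powR_ge0.
  - by move=> x; rewrite addr_ge0 ?powR_ge0.
  - exact: ltW.
  - exact: ltW.
  - move=> x _.
    rewrite (_ : fk k (psi k x) - f x = (fk k (psi k x) - g (psi k x)) +
      ((g (psi k x) - g x) + (g x - f x))); last by ring.
    apply: (le_trans (powR_add2_le _ _ p0)); rewrite ler_pM2l// lerD2l.
    exact: powR_add2_le.
apply: (@le_trans _ _ (c%:E * ((2 * eta1)%:E + c%:E * (2 * eta1)%:E))%E).
  by rewrite lee_pmul2l ?lte_fin ?fin_numE// leeD// lee_wpmul2l// lee_fin ltW.
suff -> : eta = c * (2 * eta1 + c * (2 * eta1)) by [].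
by rewrite /eta1; field; rewrite !gt_eqF ?addr_gt0.
Qed.
End Lp_convergence.

End perturbation_sequence.

(** * Sobolev arcs *)

Section sobolev_arcs.
Context (R : realType) (n : nat) (t T p : R) (y dy : R -> 'rV[R]_n).
Notation mu := (@lebesgue_measure R).
Hypotheses (p1 : 1 <= p) (tT : t <= T) (yW : W1p t T p y dy).

Lemma W1p_measurable i : measurable_fun `[t, T] (fun s => dy s ord0 i).
Proof. by case: yW => /(_ i)[]. Qed.

Lemma W1p_powR_lty i :
  (\int[mu]_(s in `[t, T]) (`|dy s ord0 i| `^ p)%:E < +oo)%E.
Proof. by case: yW => /(_ i)[]. Qed.

Lemma W1p_primitive s i : t <= s <= T ->
  y s ord0 i = y t ord0 i + \int[mu]_(x in `[t, s]) (dy x ord0 i).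
Proof. by case: yW => _ h /h. Qed.

Let integrable_powR i :
  mu.-integrable `[t, T] (EFin \o (fun s => `|dy s ord0 i| `^ p)).
Proof.
exact: (integrable_powR_norm (W1p_measurable i) (W1p_powR_lty i)).
Qed.

(** On a bounded interval |a| <= 1 + |a|^p gives L^1 from L^p. *)
Lemma W1p_integrable i : mu.-integrable `[t, T] (EFin \o (fun s => dy s ord0 i)).
Proof.
have iG : mu.-integrable `[t, T] (EFin \o (fun s => 1 + `|dy s ord0 i| `^ p)).
  apply: integrableD_EFin => //.
  by apply: (bounded_integrable_itv (C := 1)) => // x _; rewrite normr1.
apply: (le_integrable_EFin _ _ _ iG) => //; first exact: W1p_measurable.
move=> x _; have [h|h] := leP `|dy x ord0 i| 1.
  by rewrite (le_trans h)// lerDl powR_ge0.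
rewrite -[leLHS]add0r lerD// -[leLHS]powRr1//.
by apply: ler_powR => //; exact: ltW.
Qed.

Let integrable_bigsum (f : 'I_n -> R -> R) :
  (forall i, mu.-integrable `[t, T] (EFin \o f i)) ->
  mu.-integrable `[t, T] (EFin \o (fun s => \sum_(i < n) f i s)).
Proof.
move=> fi.
have -> : EFin \o (fun s => \sum_(i < n) f i s) =
    (fun s => (\sum_(i < n) (EFin \o f i) s)%E).
  by apply/funext => s /=; rewrite sumEFin.
by apply: (integrable_sum (mu := mu)).
Qed.

Lemma W1p_integrable_enorm : mu.-integrable `[t, T] (EFin \o (fun s => enorm (dy s))).
Proof.
have iG : mu.-integrable `[t, T]
    (EFin \o (fun s => \sum_(i < n) `|dy s ord0 i|)).
  by apply: integrable_bigsum => i; apply: integrable_norm; exact: W1p_integrable.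
apply: (le_integrable_EFin _ _ _ iG) => //.
  by apply: measurable_enorm => i; exact: W1p_measurable.
by move=> x _; rewrite ger0_norm ?enorm_ge0// enorm_le_sum.
Qed.

Lemma W1p_integrable_enorm_powR : (0 < n)%N ->
  mu.-integrable `[t, T] (EFin \o (fun s => enorm (dy s) `^ p)).
Proof.
move=> n0; have p0 : 0 <= p by move: p1; lra.
have iG : mu.-integrable `[t, T]
    (EFin \o (fun s => n%:R `^ p * \sum_(i < n) `|dy s ord0 i| `^ p)).
  by apply: integrableZl_EFin => //; exact: integrable_bigsum.
apply: (le_integrable_EFin _ _ _ iG) => //.
  apply: (measurableT_comp (measurable_powR p)).
  by apply: measurable_enorm => i; exact: W1p_measurable.
by move=> x _; rewrite ger0_norm ?powR_ge0// enorm_powR_le.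
Qed.

Lemma W1p_continuous i : {within `[t, T], continuous (fun s => y s ord0 i)}.
Proof.
have c : {within `[t, T], continuous
    (fun s => y t ord0 i + parameterized_integral mu t s (fun x => dy x ord0 i))}.
  move=> x; apply: cvgD; first exact: cvg_cst.
  by apply: parameterized_integral_continuous => //; exact: W1p_integrable.
apply: subspace_eq_continuous c => s; rewrite inE/= in_itv/= => sI.
by rewrite [RHS]W1p_primitive.
Qed.

Lemma W1p_increment s1 s2 i : t <= s1 -> s1 <= s2 -> s2 <= T ->
  y s2 ord0 i - y s1 ord0 i = \int[mu]_(x in `]s1, s2]) (dy x ord0 i).
Proof.
move=> ts1 s12 s2T.
rewrite -(@Rintegral_itvB _ _ (BLeft t) (BRight s2) s1)//.
- rewrite (@W1p_primitive s2) ?s2T ?(le_trans ts1)//.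
  rewrite (@W1p_primitive s1) ?ts1 ?(le_trans s12)//; ring.
- apply: integrableS (W1p_integrable i) => //.
  by apply: subset_itvl; rewrite bnd_simp.
Qed.

Lemma W1p_lipschitz C : (forall s i, t <= s <= T -> `|dy s ord0 i| <= C) ->
  Defs.lipschitz_on t T y.
Proof.
move=> dyC; exists (n%:R * C).
have coord s1 s2 i : t <= s1 -> s1 <= s2 -> s2 <= T ->
    `|y s2 ord0 i - y s1 ord0 i| <= C * (s2 - s1).
  move=> ts1 s12 s2T; rewrite W1p_increment//.
  have sub : `]s1, s2] `<=` `[t, T]%classic.
    by apply: subset_itv; rewrite bnd_simp.
  have i12 : mu.-integrable `]s1, s2] (EFin \o (fun x => dy x ord0 i)).
    by apply: integrableS (W1p_integrable i).
  apply: (le_trans (le_normr_Rintegral _ i12)) => //.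
  have : \int[mu]_(x in `]s1, s2]) `|dy x ord0 i| <= \int[mu]_(x in `]s1, s2]) cst C x.
    apply: le_Rintegral => //.
    - exact: integrable_norm.
    - by apply: (bounded_integrable_itv (C := `|C|)).
    - by move=> x xI; apply: dyC; have := sub x xI; rewrite /= in_itv.
  move=> /le_trans; apply.
  rewrite [leLHS](_ : _ = C * fine (mu `]s1, s2]%classic)); last exact: Rintegral_cst.
  rewrite lebesgue_measure_itv/= lte_fin; case: ifPn => //= s12'.
  rewrite -leNgt in s12'.
  by have -> : s2 = s1 by [apply/eqP; rewrite eq_le s12 s12']; rewrite subrr.
have main s1 s2 : t <= s1 -> s1 <= s2 -> s2 <= T ->
    enorm (y s2 - y s1) <= n%:R * C * (s2 - s1).
  move=> ts1 s12 s2T; apply: (le_trans (enorm_le_sum _)).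
  rewrite -mulrA mulr_natl -[in leRHS](card_ord n) -sumr_const.
  by apply: ler_sum => i _; rewrite !mxE; exact: coord.
have enormN (v : 'rV[R]_n) : enorm (- v) = enorm v.
  by rewrite -scaleN1r enormZ normrN1 mul1r.
move=> s1 s2 /andP[ts1 s1T] /andP[ts2 s2T].
have [s12|/ltW s21] := leP s1 s2.
  by rewrite -enormN opprB distrC ger0_norm ?subr_ge0// main.
by rewrite ger0_norm ?subr_ge0// main.
Qed.

Lemma W1p_bounded : exists K, forall s, t <= s <= T -> enorm (y s) <= K.
Proof.
exists (\sum_(i < n) (`|y t ord0 i| + \int[mu]_(x in `[t, T]) `|dy x ord0 i|)).
move=> s sI; apply: (le_trans (enorm_le_sum _)); apply: ler_sum => i _.
rewrite W1p_primitive//; apply: (le_trans (ler_normD _ _)); rewrite lerD2l.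
have sub : `[t, s] `<=` `[t, T]%classic.
  by apply: subset_itvl; rewrite bnd_simp; case/andP: sI.
have its : mu.-integrable `[t, s] (EFin \o (fun x => dy x ord0 i)).
  by apply: integrableS (W1p_integrable i).
apply: (le_trans (le_normr_Rintegral _ its)) => //.
have iT := integrable_norm (W1p_integrable i).
have ints := integrable_norm its.
apply: fine_le; [exact: integrable_fin_num ints|exact: integrable_fin_num iT|].
by apply: ge0_subset_integral => //; exact: (measurable_int mu iT).
Qed.

End sobolev_arcs.

(** * Reparametrised arcs *)

Section reparametrised_arcs.
Context (R : realType) (n : nat) (t T p : R) (y dy : R -> 'rV[R]_n)
  (E : nat -> perturbation t T) (C0 : R) (dom : R -> R).
Notation mu := (@lebesgue_measure R).
Hypotheses (p1 : 1 <= p) (n0 : (0 < n)%N) (tT : t < T) (yW : W1p t T p y dy)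
  (E_cvg : \int[mu]_x `|E k x| @[k --> \oo] --> 0)
  (E_eventually : forall x, \forall k \near \oo, E k x = 0)
  (idom : mu.-integrable `[t, T] (EFin \o dom))
  (slow : forall k x, t <= x <= T -> E k x != 0 -> enorm (dy x) / (1 + E k x) <= C0)
  (fast : forall k x, t <= x <= T -> E k x != 0 -> 1 + E k x <= dom x)
  (bound : forall k, exists C, forall x, t <= x <= T ->
    enorm (dy x) / (1 + E k x) <= C).

Local Notation psi := (clock_inv E).

(** The velocity y'/phi_k' of the competitor, read in the time s of the original arc; composing with
    psi_k gives its derivative in its own time. *)
Definition slowed k s := (1 + E k s)^-1 *: dy s.
Definition arc k s := y (psi k s).
Definition arc_deriv k s := slowed k (psi k s).

Let tT' : t <= T. Proof. exact: ltW. Qed.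

Let arc_derivE k s i :
  arc_deriv k s ord0 i = dy (psi k s) ord0 i / (1 + E k (psi k s)).
Proof. by rewrite /arc_deriv /slowed mxE mulrC. Qed.

Lemma enorm_slowed k s : enorm (slowed k s) = enorm (dy s) / (1 + E k s).
Proof.
by rewrite /slowed enormZ mulrC ger0_norm// invr_ge0 ltW// one_pert_gt0.
Qed.

Lemma arc_left k : arc k t = y t.
Proof.
rewrite /arc /clock_inv.
by rewrite (tchange_inv_left _ (pert_ge (E k)) (@pert_out _ _ _ (E k))).
Qed.

Lemma arc_right k : \int[mu]_x E k x = 0 -> arc k T = y T.
Proof.
move=> E0; rewrite /arc /clock_inv.
by rewrite (tchange_inv_right _ (pert_ge (E k)) (@pert_out _ _ _ (E k)) E0).
Qed.

Let measurable_dy i : measurable_fun `[t, T] (fun s => dy s ord0 i).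
Proof. exact: W1p_measurable yW i. Qed.

Lemma measurable_arc_deriv k i :
  measurable_fun `[t, T] (fun s => arc_deriv k s ord0 i).
Proof.
rewrite (_ : (fun s => _) =
    (fun s => dy s ord0 i / (1 + E k s)) \o psi k); last first.
  by apply/funext => s /=; rewrite arc_derivE.
by apply: measurable_comp_clock_inv => //; exact: measurable_slowed.
Qed.

Lemma arc_deriv_bounded k : exists C, forall s i, t <= s <= T ->
  `|arc_deriv k s ord0 i| <= C.
Proof.
have [C HC] := bound k; exists C => s i sI.
apply: (le_trans (coord_le_enorm _ _)).
by rewrite enorm_slowed HC// clock_inv_itv.
Qed.

(** The change of variables cancels phi_k': the integral of (y'/phi_k') o psi_k over [t, s] is that
    of y' over [t, psi_k(s)], which is y(psi_k(s)) - y(t). Membership in L^p is immediate, the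
    derivative being bounded. *)
Lemma arc_W1p k : W1p t T p (arc k) (arc_deriv k).
Proof.
have p0 : 0 <= p by move: p1; lra.
split=> [i|s sI i].
  split; first exact: measurable_arc_deriv.
  have [C HC] := arc_deriv_bounded k.
  apply: (@integrable_lty _ _ _ mu _ _ (EFin \o (fun s => `|arc_deriv k s ord0 i| `^ p))) => //.
  apply: (bounded_integrable_itv (C := C `^ p)).
    by apply: measurable_powR_norm; exact: measurable_arc_deriv.
  move=> x; rewrite /= in_itv/= => xI; rewrite ger0_norm ?powR_ge0//.
  have h := HC x i xI.
  by apply: ge0_ler_powR; rewrite ?nnegrE// (le_trans _ h).
rewrite arc_left /arc (W1p_primitive yW); last exact: clock_inv_itv.
congr +%R; congr fine; apply/esym.
transitivity (\int[mu]_(x in `[t, s]) (dy (psi k x) ord0 i / (1 + E k (psi k x)))%:E)%E.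
  by apply: eq_integral => x _; rewrite arc_derivE.
rewrite (integral_comp_clock_inv E k sI (measurable_slowed E k (measurable_dy i))).
by apply: eq_integral => x _; rewrite divfK// gt_eqF// one_pert_gt0.
Qed.

Lemma arc_lipschitz k : Defs.lipschitz_on t T (arc k).
Proof.
by have [C HC] := arc_deriv_bounded k; exact: (W1p_lipschitz p1 (arc_W1p k) HC).
Qed.

Lemma arc_W1p_cvg :
  W1p_dist t T p (arc k) (arc_deriv k) y dy @[k --> \oo] --> 0%E.
Proof.
have p0 : 0 <= p by move: p1; lra.
have [K HK] := W1p_bounded p1 yW.
have my i : measurable_fun `[t, T] (fun s => y s ord0 i).
  apply: subspace_continuous_measurable_fun; first exact: measurable_itv.
  exact: (W1p_continuous p1 tT' yW).
(* Reduction to coordinates: the p-th power of the Euclidean norm is at most n^p times the sum of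
   the p-th powers of the coordinates. *)
have sum_cvg (u : nat -> R -> 'rV[R]_n) :
    (forall k i, measurable_fun `[t, T] (fun s => u k s ord0 i)) ->
    (forall i, (\int[mu]_(s in `[t, T]) (`|u k s ord0 i| `^ p)%:E @[k --> \oo] --> 0)%E) ->
    (\int[mu]_(s in `[t, T]) (enorm (u k s) `^ p)%:E @[k --> \oo] --> 0)%E.
  move=> mu_ ucvg.
  have mui k i : measurable_fun `[t, T] (fun s => (`|u k s ord0 i| `^ p)%:E).
    by apply/measurable_EFinP; apply: measurable_powR_norm; exact: mu_.
  pose S k := (\sum_(i < n) \int[mu]_(s in `[t, T]) (`|u k s ord0 i| `^ p)%:E)%E.
  have Scvg : ((n%:R `^ p)%:E * S k)%E @[k --> \oo] --> 0%E.
    rewrite -[0%E](mule0 (n%:R `^ p)%:E); apply: cvgeZl => //.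
    rewrite /S; elim: (index_enum _) => [|i r IH].
      by under eq_fun do rewrite big_nil; exact: cvg_cst.
    under eq_fun do rewrite big_cons.
    by have := cvgeD (isT : (0 +? 0)%E) (ucvg i) IH; rewrite adde0; apply.
  apply: (squeeze_cvge _ (cvg_cst 0%E) Scvg).
  apply: nearW => k; apply/andP; split.
    by apply: integral_ge0 => x _; rewrite lee_fin powR_ge0.
  have pos i x : (0 <= (`|u k x ord0 i| `^ p)%:E)%E by rewrite lee_fin powR_ge0.
  have msum : measurable_fun `[t, T] (fun s => \sum_(i < n) (`|u k s ord0 i| `^ p)%:E)%E.
    by apply: emeasurable_sum => i; exact: mui.
  rewrite /S -ge0_integral_sum//; last by move=> i; exact: mui.
  rewrite -ge0_integralZl//.
  - apply: ge0_le_integral => //.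
    + by move=> x _; rewrite lee_fin powR_ge0.
    + apply/measurable_EFinP; apply: (measurableT_comp (measurable_powR p)).
      by apply: measurable_enorm => i; exact: mu_.
    + exact: measurable_funeM.
    + by move=> x _; rewrite sumEFin -EFinM lee_fin enorm_powR_le.
  - by move=> x _; apply: sume_ge0.
rewrite /W1p_dist -[X in _ --> X](adde0 0%E).
apply: (cvgeD (isT : (0 +? 0)%E)).
  apply: sum_cvg => [k i|i].
    rewrite (_ : (fun s => _) = (fun s => y (psi k s) ord0 i - y s ord0 i)); last first.
      by apply/funext => s; rewrite !mxE.
    by apply: measurable_funB => //; exact: (measurable_comp_clock_inv E k (my i)).
  rewrite (_ : (fun k => _) = (fun k => \int[mu]_(s in `[t, T])
      (`|y (psi k s) ord0 i - y s ord0 i| `^ p)%:E)%E); last first.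
    by apply/funext => k; apply: eq_integral => s _; rewrite !mxE.
  have yK x : t <= x <= T -> `|y x ord0 i| <= K.
    by move=> xI; apply: le_trans (HK x xI); exact: coord_le_enorm.
  have yc : {within `[t, T], continuous (fun x => y x ord0 i)}.
    exact: (W1p_continuous p1 tT' yW).
  exact: (Lp_translate_cvg tT' E_cvg p1 yc yK).
apply: sum_cvg => [k i|i].
  rewrite (_ : (fun s => _) = (fun s => arc_deriv k s ord0 i - dy s ord0 i)); last first.
    by apply/funext => s; rewrite !mxE.
  by apply: measurable_funB => //; exact: measurable_arc_deriv.
rewrite (_ : (fun k => _) = (fun k => \int[mu]_(s in `[t, T])
    (`|dy (psi k s) ord0 i / (1 + E k (psi k s)) - dy s ord0 i| `^ p)%:E)%E); last first.
  by apply/funext => k; apply: eq_integral => s _; rewrite -arc_derivE !mxE.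
have dyC k x : t <= x <= T -> E k x != 0 -> `|dy x ord0 i / (1 + E k x)| <= C0.
  move=> xI Ex; apply: le_trans (slow xI Ex); rewrite -enorm_slowed.
  by have := coord_le_enorm (slowed k x) i; rewrite mxE mulrC.
exact: (Lp_clock_cvg tT' E_cvg E_eventually p1 (measurable_dy i)
  (W1p_powR_lty yW i) idom dyC fast).
Qed.

End reparametrised_arcs.

(** * Convergence of the energy *)

Section energy.
Context (R : realType) (n : nat) (t T p : R)
  (Lam : R -> 'rV[R]_n -> 'rV[R]_n -> \bar R) (Psi : R -> 'rV[R]_n -> \bar R).
Notation mu := (@lebesgue_measure R).
Hypotheses
  (mLam : borel_fun_on [set x : R * 'rV[R]_n * 'rV[R]_n | t <= x.1.1 <= T]
    (fun x => Lam x.1.1 x.1.2 x.2))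
  (mPsi : borel_fun_on [set x : R * 'rV[R]_n | t <= x.1 <= T]
    (fun x => Psi x.1 x.2)).

Lemma measurable_lagrangian d (X : measurableType d) (D : set X)
    (a : X -> R) (b c : X -> 'rV[R]_n) : measurable D ->
  measurable_fun D a -> (forall i, measurable_fun D (fun s => b s ord0 i)) ->
  (forall i, measurable_fun D (fun s => c s ord0 i)) ->
  (forall x, D x -> t <= a x <= T) ->
  measurable_fun D (fun s => (Lam (a s) (b s) (c s) * Psi (a s) (b s))%E).
Proof.
move=> mD ma mb mc aI; apply: emeasurable_funM.
  exact: (borel_measurable_comp mD mLam (borel_measurable_triple mD ma mb mc)).
exact: (borel_measurable_comp mD mPsi (borel_measurable_pair mD ma mb)).
Qed.

Context (y dy : R -> 'rV[R]_n) (E : nat -> perturbation t T) (dom : R -> R)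
  (kappa beta eps M : R) (gamma : R -> R).
Hypotheses (Lam0 : forall s z u, (0 <= Lam s z u)%E)
  (Psi0 : forall s z, (0 <= Psi s z)%E)
  (p1 : 1 <= p) (n0 : (0 < n)%N) (tT : t < T) (yW : W1p t T p y dy)
  (E_cvg : \int[mu]_x `|E k x| @[k --> \oo] --> 0)
  (E_eventually : forall x, \forall k \near \oo, E k x = 0)
  (E_small : forall k, \int[mu]_x `|E k x| <= eps)
  (idom : mu.-integrable `[t, T] (EFin \o dom))
  (iLam : mu.-integrable `[t, T] (fun s => Lam s (y s) (dy s)))
  (fin_indep : forall s s' z u, t <= s <= T -> t <= s' <= T ->
    (Lam s z u < +oo)%E -> (Lam s' z u < +oo)%E)
  (kappa0 : 0 <= kappa) (beta0 : 0 <= beta)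
  (igamma : mu.-integrable `[t, T] (EFin \o gamma)) (M0 : 0 <= M)
  (hS : {ae mu, forall s, t <= s <= T -> (Lam s (y s) (dy s) < +oo)%E ->
     forall s2, `|s2 - s| <= eps -> t <= s2 <= T ->
     (`|Lam s2 (y s) (dy s) - Lam s (y s) (dy s)| <=
       (kappa%:E * Lam s (y s) (dy s) + (beta * enorm (dy s) `^ p + gamma s)%:E)
         * `|s2 - s|%:E)%E})
  (PsiM : forall s x, t <= s <= T -> t <= x <= T -> (Psi s (y x) <= M%:E)%E)
  (cPsi : forall x, t <= x <= T -> {within `[t, T], continuous (fun s => Psi s (y x))})
  (Lam_dom : forall k x s, t <= x <= T -> t <= s <= T -> E k x != 0 ->
    (Lam s (y x) (slowed dy E k x) * (1 + E k x)%:E <= (dom x)%:E)%E).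

Local Notation phi := (clock E).
Local Notation psi := (clock_inv E).

Let tT' : t <= T. Proof. exact: ltW. Qed.

Lemma clock_itv k s : t <= s -> s <= psi k T -> t <= phi k s <= T.
Proof.
move=> ts sT; have ge := pert_ge (E k); have ie := pert_integrable (E k).
rewrite /clock (tchange_leE (pert_integrable (E k)) ge) sT andbT.
rewrite -[leLHS](tchange_left ie (@pert_out _ _ _ (E k))).
by rewrite (tchange_le ie).
Qed.

Lemma clock_dist k s : `|phi k s - s| <= \int[mu]_x `|E k x|.
Proof. exact: tchange_dist (pert_integrable (E k)) s. Qed.

Lemma clock_cvg s : phi k s @[k --> \oo] --> s.
Proof.
apply/cvgrPdist_le => e e0.
move/cvgr0Pnorm_le : E_cvg => /(_ e e0); apply: filterS => k.
by rewrite ger0_norm ?Rintegral_ge0// distrC; apply: le_trans; exact: clock_dist.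
Qed.

Let g k s := (Lam (phi k s) (y s) (slowed dy E k s) * Psi (phi k s) (y s) *
  (1 + E k s)%:E)%E.

Let measurable_y i : measurable_fun `[t, T] (fun s => y s ord0 i).
Proof.
apply: subspace_continuous_measurable_fun; first exact: measurable_itv.
exact: (W1p_continuous p1 tT' yW).
Qed.

(** The energy pulled back to the original clock. Its domain [t, psi_k(T)] varies with k, so it is
    encoded as a restriction on the fixed interval [t, T], ready for dominated convergence. *)
Lemma energy_arc k : Ffun t T Lam Psi (arc y E k) (arc_deriv dy E k) =
  (\int[mu]_(s in `[t, T]) (g k \_ `[t, psi k T]) s)%E.
Proof.
have ge := pert_ge (E k); have ie := pert_integrable (E k).
have me := pert_measurable (E k).
have psiT : psi k T <= T.
  by have /andP[] : t <= psi k T <= T by apply: clock_inv_itv => //; rewrite tT' lexx.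
rewrite /Ffun -integral_mkcondr (_ : _ `&` _ = `[t, psi k T]%classic); last first.
  apply/seteqP; split=> s; rewrite /= !in_itv/=; first by case.
  by move=> /andP[ts sT]; rewrite ts sT (le_trans sT).
rewrite (integral_tchange me ie ge)//; last 2 first.
- apply: measurable_lagrangian => //.
  + by move=> i; exact: (measurable_comp_clock_inv E k (measurable_y i)).
  + by move=> i; exact: (measurable_arc_deriv E yW k i).
- by move=> x _; apply: mule_ge0.
rewrite (tchange_preimage (pert_integrable (E k)) ge (@pert_out _ _ _ (E k))).
apply: eq_integral => s _; rewrite /g /arc /arc_deriv.
by rewrite (_ : psi k (tchange (E k) s) = s)//; exact: tchangeK.
Qed.

Let mg k : measurable_fun `[t, T] (g k \_ `[t, psi k T]).
Proof.
have psiT : psi k T <= T.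
  by have /andP[] : t <= psi k T <= T by apply: clock_inv_itv => //; rewrite tT' lexx.
apply/measurable_restrict => //.
rewrite (_ : _ `&` _ = `[t, psi k T]%classic); last first.
  apply/seteqP; split=> s; rewrite /= !in_itv/=; first by case.
  by move=> /andP[ts sT]; rewrite ts sT (le_trans sT).
have sub : `[t, psi k T] `<=` `[t, T]%classic by apply: subset_itvl; rewrite bnd_simp.
apply: emeasurable_funM.
  apply: measurable_lagrangian => //.
  - apply: measurable_funTS; apply: measurable_tchange (pert_ge (E k)).
    exact: pert_integrable.
  - by move=> i; apply: measurable_funS (measurable_y i).
  - move=> i; rewrite (_ : (fun s => _) = (fun s => dy s ord0 i / (1 + E k s))); last first.
      by apply/funext => s; rewrite /slowed mxE mulrC.
    by apply: measurable_funS (measurable_slowed E k (W1p_measurable yW i)).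
  - by move=> x; rewrite /= in_itv/= => /andP[tx xT]; exact: clock_itv.
by apply/measurable_EFinP; apply: measurable_funD => //; exact: measurable_pert.
Qed.

(** The dominating function: [dom] covers the perturbed set, and elsewhere [Lam] at the shifted time
    is at most its value at s plus the error of Condition (S) for a shift of at most eps; M bounds
    [Psi]. *)
Let G s := (M%:E * (`|dom s|%:E + Lam s (y s) (dy s) +
  (kappa%:E * Lam s (y s) (dy s) + (beta * enorm (dy s) `^ p + `|gamma s|)%:E) * eps%:E))%E.

Let iG : mu.-integrable `[t, T] G.
Proof.
apply: integrableZl => //; apply: integrableD => //.
  apply: integrableD => //; exact: (integrable_norm idom).
apply: integrableZr => //; apply: integrableD => //; first exact: integrableZl.
apply: integrableD_EFin => //; last exact: integrable_norm.
by apply: integrableZl_EFin => //; exact: (W1p_integrable_enorm_powR p1 yW n0).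
Qed.

(** A point s < T eventually lies below psi_k(T), since psi_k(T) -> T, and so is not cut off by the
    restriction; at s = T this could fail for every k. *)
Let good s := [/\ s != T, (Lam s (y s) (dy s) \is a fin_num) &
  forall s2, `|s2 - s| <= eps -> t <= s2 <= T ->
     (`|Lam s2 (y s) (dy s) - Lam s (y s) (dy s)| <=
       (kappa%:E * Lam s (y s) (dy s) + (beta * enorm (dy s) `^ p + gamma s)%:E)
         * `|s2 - s|%:E)%E].

Let ae_good : {ae mu, forall s, t <= s <= T -> good s}.
Proof.
have aeT : {ae mu, forall s, s != T}.
  exists [set T]; split => //; first exact: lebesgue_measure_set1.
  by move=> s /=; case: eqVneq.
have aef : {ae mu, forall s, `[t, T]%classic s -> Lam s (y s) (dy s) \is a fin_num}.
  by apply: (integrable_ae _ iLam) => //; exact: measurable_itv.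
apply: (filterS3 (ae_filter_ringOfSetsType mu) _ hS aeT aef) => s hs sT fs sI.
have {}fs : Lam s (y s) (dy s) \is a fin_num by apply: fs; rewrite /= in_itv.
by split=> //; apply: hs => //; rewrite -ge0_fin_numE.
Qed.

Let PsiE s x : t <= s <= T -> t <= x <= T ->
  exists2 P : R, Psi s (y x) = P%:E & 0 <= P <= M.
Proof.
move=> sI xI; have := Psi0 s (y x); have := PsiM sI xI.
by case: (Psi s (y x)) => [P| |]//; rewrite !lee_fin => h1 h2; exists P => //; rewrite h1 h2.
Qed.

(** Finiteness of [Lam] does not depend on time, so both values are real and Condition (S) becomes
    an inequality between real numbers. *)
Let LamE s x : good x -> t <= s <= T -> t <= x <= T -> `|s - x| <= eps ->
  exists L L' : R, [/\ Lam x (y x) (dy x) = L%:E, Lam s (y x) (dy x) = L'%:E,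
    0 <= L, 0 <= L' &
    `|L' - L| <= (kappa * L + (beta * enorm (dy x) `^ p + gamma x)) * `|s - x|].
Proof.
move=> [_ fx hx] sI xI sx; have := hx s sx sI.
have /fineK := fx; set L := fine _ => LE.
have Lfin : (Lam s (y x) (dy x) < +oo)%E.
  by apply: (fin_indep xI sI); rewrite -LE ltry.
have /fineK : Lam s (y x) (dy x) \is a fin_num by rewrite ge0_fin_numE.
set L' := fine _ => L'E.
rewrite -LE -L'E => h; exists L, L'; split=> //.
- by have := Lam0 x (y x) (dy x); rewrite -LE lee_fin.
- by have := Lam0 s (y x) (dy x); rewrite -L'E lee_fin.
Qed.

Let slowed_id k s : E k s = 0 -> slowed dy E k s = dy s.
Proof. by move=> e; rewrite /slowed e addr0 invr1 scale1r. Qed.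

(** Eventually E_k(s) = 0 and the integrand is Lam(phi_k(s), y(s), y'(s)) Psi(phi_k(s), y(s)); only
    phi_k(s) -> s remains to be passed to the limit. *)
Let pointwise s : t <= s <= T -> good s ->
  (g k \_ `[t, psi k T]) s @[k --> \oo] --> (Lam s (y s) (dy s) * Psi s (y s))%E.
Proof.
move=> sI gs; have /andP[ts sT] := sI.
have sT' : s < T by rewrite lt_neqAle sT andbT; case: gs.
have ev : \forall k \near \oo, s <= psi k T.
  have cT : psi k T @[k --> \oo] --> T by exact: clock_inv_cvg.
  move/cvgrPdist_le : cT => /(_ (T - s)); rewrite subr_gt0 => /(_ sT').
  by apply: filterS => k /(le_trans (ler_norm _)); lra.
have evI : \forall k \near \oo, t <= phi k s <= T.
  by apply: filterS ev => k; exact: clock_itv.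
have [L LE] : exists L : R, Lam s (y s) (dy s) = L%:E.
  by case: (gs) => _ fs _; exists (fine (Lam s (y s) (dy s))); rewrite fineK.
have [P PE _] := PsiE sI sI.
set c := kappa * L + (beta * enorm (dy s) `^ p + gamma s).
have cLam : Lam (phi k s) (y s) (dy s) @[k --> \oo] --> L%:E.
  apply/fine_cvgP; split.
    apply: filterS evI => k kI; rewrite ge0_fin_numE//.
    by apply: (fin_indep sI kI); rewrite LE ltry.
  have cz : `|c| * `|phi k s - s| @[k --> \oo] --> 0.
    rewrite -[X in _ --> X](mulr0 `|c|); apply: cvgMr; apply/norm_cvg0P.
    by rewrite -(subrr s); apply: cvgB; [exact: clock_cvg|exact: cvg_cst].
  apply/cvgrPdist_le => e e0; move/cvgr0Pnorm_le : cz => /(_ e e0).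
  apply: filterS2 evI => k kI; rewrite ger0_norm ?mulr_ge0// => ke.
  have [L1 [L2 [L1E L2E _ _ h]]] := LamE gs kI sI (le_trans (clock_dist k s) (E_small k)).
  move: L1E; rewrite LE => -[?]; subst L1.
  rewrite /= L2E /= distrC; apply: (le_trans h); apply: le_trans ke.
  by rewrite ler_wpM2r// ler_norm.
have cP : Psi (phi k s) (y s) @[k --> \oo] --> P%:E.
  rewrite -PE; apply: (within_continuous_cvg (cPsi sI) sI) => //; exact: clock_cvg.
rewrite LE PE.
have cLP : (Lam (phi k s) (y s) (dy s) * Psi (phi k s) (y s))%E @[k --> \oo] --> (L%:E * P%:E)%E.
  exact: (cvgeM (isT : (L%:E *? P%:E)%E) cLam cP).
apply: cvg_trans cLP; apply: near_eq_cvg.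
apply: filterS2 ev (E_eventually s) => k sk Ek.
rewrite patchE mem_set; last by rewrite /= in_itv/= ts sk.
by rewrite /g slowed_id// Ek addr0 mule1.
Qed.

Let domination s k : t <= s <= T -> good s ->
  (`|(g k \_ `[t, psi k T]) s| <= G s)%E.
Proof.
move=> sI gs; have eps0 : 0 <= eps by apply: le_trans (E_small 0); exact: Rintegral_ge0.
have [L LE L0] : exists2 L : R, Lam s (y s) (dy s) = L%:E & 0 <= L.
  case: (gs) => _ fs _; exists (fine (Lam s (y s) (dy s))); rewrite ?fineK//.
  exact: fine_ge0.
pose c := kappa * L + (beta * enorm (dy s) `^ p + `|gamma s|).
have c0 : 0 <= c by rewrite !addr_ge0 ?mulr_ge0 ?powR_ge0.
have GE : G s = (M * (`|dom s| + L + c * eps))%:E by rewrite /G LE.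
have G0 : (0 <= G s)%E by rewrite GE lee_fin mulr_ge0// !addr_ge0// mulr_ge0.
rewrite patchE; case: ifPn => [|_]; last by rewrite abse0.
rewrite inE/= in_itv/= => /andP[ts sk].
have kI := clock_itv ts sk; have [P PE /andP[P0 PM]] := PsiE kI sI.
rewrite /g; have [Ek|Ek] := eqVneq (E k s) 0.
  have [L1 [L2 [L1E L2E _ L20 h]]] := LamE gs kI sI (le_trans (clock_dist k s) (E_small k)).
  move: L1E; rewrite LE => -[?]; subst L1.
  rewrite slowed_id// Ek addr0 mule1 L2E PE GE -EFinM lee_fin.
  rewrite ger0_norm ?mulr_ge0// mulrC ler_pM//.
  have hc : L2 - L <= c * eps.
    apply: (le_trans (ler_norm _)); apply: (le_trans h).
    apply: (@le_trans _ _ (c * `|phi k s - s|)).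
      by rewrite ler_wpM2r// lerD2l lerD2l ler_norm.
    by rewrite ler_wpM2l// (le_trans (clock_dist k s)).
  by have := normr_ge0 (dom s); lra.
have h := Lam_dom sI kI Ek.
have rho0 : (0 <= (1 + E k s)%:E)%E by rewrite lee_fin ltW// one_pert_gt0.
rewrite gee0_abs; last by rewrite !mule_ge0.
rewrite muleAC PE GE.
have d0 : 0 <= dom s.
  by rewrite -lee_fin; apply: le_trans h; rewrite mule_ge0.
apply: (@le_trans _ _ ((dom s)%:E * M%:E)%E).
  by apply: lee_pmul => //; rewrite ?mule_ge0 ?lee_fin.
rewrite -EFinM lee_fin mulrC ler_wpM2l// ger0_norm//.
by have : 0 <= c * eps by [rewrite mulr_ge0]; lra.
Qed.

Lemma energy_cvg : Ffun t T Lam Psi (arc y E k) (arc_deriv dy E k) @[k --> \oo]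
  --> Ffun t T Lam Psi y dy.
Proof.
under eq_fun do rewrite energy_arc.
have [] // := @dominated_convergence _ _ _ mu `[t, T]%classic (measurable_itv _)
  (fun k => g k \_ `[t, psi k T]) (fun s => Lam s (y s) (dy s) * Psi s (y s))%E G.
- apply: measurable_lagrangian => //.
  by move=> i; exact: (W1p_measurable yW).
- apply: (@filterS _ _ (ae_filter_ringOfSetsType mu) _ _ _ ae_good)
    => s h; rewrite /= in_itv/= => sI.
  exact: pointwise (h sI).
- apply: (@filterS _ _ (ae_filter_ringOfSetsType mu) _ _ _ ae_good)
    => s h k; rewrite /= in_itv/= => sI.
  exact: domination (h sI).
Qed.

End energy.

(** * Construction of the clocks *)

(** Contrapositive of countable subadditivity. *)
Lemma lebesgue_bigcup_gt0 (R : realType) (F : nat -> set R) :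
  (forall k, measurable (F k)) -> (0 < lebesgue_measure (\bigcup_k F k))%E ->
  exists k, (0 < lebesgue_measure (F k))%E.
Proof.
move=> mF; apply: contraPP => /forallNP F0; apply/negP; rewrite -leNgt.
have F0' k : lebesgue_measure (F k) = 0%E.
  by apply/eqP; rewrite eq_le measure_ge0 andbT leNgt; apply/negP.
rewrite (le_trans (measure_sigma_subadditive _ _ _ (@subset_refl _ _)))//.
- by apply: bigcup_measurable => k _; exact: mF.
- by rewrite eseries0// => k _ _; exact: F0'.
Qed.

Section shrinking.
Context (R : realType).
Notation mu := (@lebesgue_measure R).

(** The sets must leave every point, so that the perturbed clock is eventually
unperturbed at each point and dominated convergence applies. *)
Lemma shrinking_sets (c d : R) (A : set R) :
  measurable A -> A `<=` `[c, d] -> (0 < lebesgue_measure A)%E ->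
  exists S : nat -> set R, [/\ forall k, measurable (S k), forall k, S k `<=` A,
    forall k, (0 < lebesgue_measure (S k))%E &
    forall x, \forall k \near \oo, ~ S k x].
Proof.
move=> mA Acd A0.
pose B := [set x | (0 < mu (A `&` `]-oo, x]%classic))%E].
have mAI x : measurable (A `&` `]-oo, x]%classic) by exact: measurableI.
have Bc x : B x -> c <= x.
  rewrite leNgt => Bx; apply/negP => xc; move: Bx; rewrite /B /=.
  rewrite (_ : _ `&` _ = set0) ?measure0 ?ltxx//.
  apply/seteqP; split=> z //= [/Acd]; rewrite /= !in_itv/= => /andP[cz _] zx.
  by have := le_lt_trans (le_trans cz zx) xc; rewrite ltxx.
have Bd : B d.
  rewrite /B /= (_ : _ `&` _ = A)//; apply/seteqP; split=> z /=; first by case.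
  by move=> Az; split=> //; have := Acd z Az; rewrite /= !in_itv/= => /andP[].
have infB : has_inf B by split; [exists d|exists c => x; exact: Bc].
(* [a] is the leftmost point of positive mass of [A]: every ]a, a + e] meets it. *)
pose a := inf B.
have null x : x < a -> mu (A `&` `]-oo, x]%classic) = 0%E.
  move=> xa; apply/eqP; rewrite eq_le measure_ge0 andbT leNgt; apply/negP => Bx.
  by have := inf_lbound infB.2 Bx; rewrite leNgt xa.
have pos e : 0 < e -> (0 < mu (A `&` `]-oo, (a + e)%R]%classic))%E.
  move=> e0; have [x Bx xa] := inf_adherent e0 infB.
  apply: (lt_le_trans Bx); apply: le_measure; rewrite ?inE; [exact: mAI|exact: mAI|].
  by apply: setIS => z; rewrite /= !in_itv/= => /le_trans; apply; exact: ltW.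
(* The interval is open at a, so points up to a are never in S k and points beyond a leave once
   1/(k+1) is small. *)
pose S k := A `&` `]a, (a + k.+1%:R^-1)%R]%classic.
have mS k : measurable (S k) by exact: measurableI.
exists S; split=> //; first by move=> k x [].
  move=> k; rewrite lt0e measure_ge0 andbT; apply/negP => /eqP S0.
  have k0 : 0 < k.+1%:R^-1 :> R by rewrite invr_gt0.
  (* If S k were null, the part of A up to a + 1/(k+1) would be covered by countably many null sets:
     S k with the point a, and the parts of A up to a - 1/(m'+1), null because a is an infimum. *)
  pose F m := if m is m'.+1 then A `&` `]-oo, (a - m'.+1%:R^-1)%R]%classic
    else S k `|` [set a].
  have mF m : measurable (F m) by case: m => [|m] //=; apply: measurableU.
  have [m] : exists m, (0 < mu (F m))%E.
    apply: lebesgue_bigcup_gt0 => //; apply: (lt_le_trans (pos _ k0)).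
    apply: le_measure; rewrite ?inE.
    - exact: mAI.
    - by apply: bigcup_measurable => m _; exact: mF.
    move=> z [Az]; rewrite /= in_itv/= => zk.
    have [za|az|->] := ltgtP z a.
    - have [m] := ltr_add_invr za; move=> zm; exists m.+1 => //=; split=> //.
      by rewrite in_itv/= lerBrDr ltW.
    - by exists 0 => //=; left; split=> //; rewrite /= in_itv/= az.
    - by exists 0 => //=; right.
  case: m => [|m] /=.
    rewrite (_ : mu _ = 0%E) ?ltxx//; apply/eqP; rewrite eq_le measure_ge0 andbT.
    apply: (@le_trans _ _ (mu (S k) + mu [set a])%E).
      by apply: measureU2; [exact: mS|exact: measurable_set1].
    by rewrite S0 add0e lebesgue_measure_set1.
  by rewrite null ?ltxx// ltrBlDr ltrDl.
move=> x; have [xa|ax] := leP x a.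
  by apply: nearW => k [_]; rewrite /= in_itv/= ltNge xa.
have xa : 0 < x - a by rewrite subr_gt0.
have := near_infty_natSinv_lt (PosNum xa); apply: filterS => k /= kx [_].
rewrite /= in_itv/= => /andP[_]; rewrite leNgt; apply/negP; rewrite negbK.
by rewrite -ltrBrDl.
Qed.

End shrinking.

Section spikes.
Context (R : realType) (t T nu0 : R) (f : R -> R).
Notation mu := (@lebesgue_measure R).
Hypotheses (tT : t <= T) (nu00 : 0 < nu0) (mf : measurable_fun `[t, T] f)
  (f0 : forall x, 0 <= f x) (fi : mu.-integrable `[t, T] (EFin \o f)).

(** The value of phi' - 1 for which the speed f/phi' becomes exactly nu0 on the spikes f > j. *)
Let spike0 (j : nat) x := if j%:R < f x then f x / nu0 - 1 else 0.

Definition spike j := spike0 j \_ `[t, T].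

Let spike_in j x : t <= x <= T -> spike j x = spike0 j x.
Proof. by move=> xI; rewrite /spike patchE mem_set//= in_itv. Qed.

Let spike_out j x : ~ (t <= x <= T) -> spike j x = 0.
Proof. by move=> xI; rewrite /spike patchE memNset//= in_itv. Qed.

Let mspike0 j : measurable_fun `[t, T] (spike0 j).
Proof.
apply: measurable_fun_if => //; first exact: measurable_fun_ltr.
apply: (measurable_funS (measurable_itv _)) (_ : _ `<=` `[t, T]) _; first by move=> x [].
by apply: measurable_funB => //; exact: measurable_funM.
Qed.

Lemma measurable_spike j : measurable_fun setT (spike j).
Proof. by apply/(measurable_restrictT _ _).1. Qed.

Let dom0 x := nu0^-1 * f x + 1.

Let spike0_le j x : `|spike0 j x| <= dom0 x.
Proof.
have q0 : 0 <= nu0^-1 * f x by rewrite mulr_ge0// invr_ge0 ltW.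
rewrite /spike0 /dom0; case: ifP => _; last by rewrite normr0 addr_ge0.
by apply: (le_trans (ler_normB _ _)); rewrite normr1 mulrC ger0_norm.
Qed.

Let idom0 : mu.-integrable `[t, T] (EFin \o dom0).
Proof.
apply: integrableD_EFin => //; first exact: integrableZl_EFin.
by apply: (bounded_integrable_itv (C := 1)) => // x _; rewrite normr1.
Qed.

Lemma integrable_spike j : mu.-integrable setT (EFin \o spike j).
Proof.
rewrite /spike -restrict_EFin; apply/integrable_restrict => //=; rewrite setTI.
by apply: (le_integrable_EFin _ _ _ idom0) => //; exact: mspike0.
Qed.

Let spike_ge0 (j : nat) x : nu0 <= j%:R -> 0 <= spike j x.
Proof.
move=> nj; have [xI|xI] := pselect (t <= x <= T); last by rewrite spike_out.
rewrite spike_in// /spike0; case: ifP => // jf.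
by rewrite subr_ge0 ler_pdivlMr// mul1r ltW// (le_lt_trans nj).
Qed.

(** The time gained on the spikes above height j. *)
Definition spike_mass j := \int[mu]_x spike j x.

Lemma spike_mass_cvg : spike_mass j @[j --> \oo] --> 0.
Proof.
have iG : mu.-integrable setT (EFin \o (dom0 \_ `[t, T])).
  by rewrite -restrict_EFin; apply/integrable_restrict => //=; rewrite setTI.
have : (\int[mu]_x (spike j x)%:E @[j --> \oo] --> \int[mu]_x (0%R)%:E)%E.
  apply: (dominated_convergence_EFin _ _ iG) => //.
  - by move=> j; exact: measurable_spike.
  - move=> x _; apply: cvg_near_cst.
    have := @nbhs_infty_ger R (f x); apply: filterS => j fj.
    have [xI|xI] := pselect (t <= x <= T); last by rewrite spike_out.
    by rewrite spike_in// /spike0 ltNge fj.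
  - move=> x _ j; have [xI|xI] := pselect (t <= x <= T).
      by rewrite spike_in// patchE mem_set ?spike0_le//= in_itv.
    rewrite spike_out// normr0 patchE; case: ifP => // _.
    by apply: le_trans (spike0_le 0 x).
by rewrite integral0 => /fine_cvg.
Qed.

(** The perturbation is the spike minus theta on S. The condition r <= j makes S disjoint from the
    spikes, nu0 <= j makes the spikes nonnegative, theta <= 1/2 gives the lower bound -1/2. The mass
    condition keeps the total nonnegative and makes the L^1 norm at most twice the gain. *)
Lemma spike_perturbation (j : nat) (r theta : R) (S : set R) :
  nu0 <= j%:R -> r <= j%:R -> measurable S -> S `<=` `[t, T] ->
  (forall x, S x -> f x <= r) -> 0 <= theta <= 2^-1 ->
  theta * fine (mu S) <= spike_mass j ->
  exists E : perturbation t T,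
    [/\ \int[mu]_x E x = spike_mass j - theta * fine (mu S),
      \int[mu]_x `|E x| <= 2 * spike_mass j,
      (forall x, f x <= j%:R -> ~ S x -> E x = 0),
      (forall x, t <= x <= T -> E x = 0 -> f x <= j%:R) &
      (forall x, t <= x <= T -> E x != 0 ->
        (nu0 <= f x /\ 1 + E x = f x / nu0) \/ (S x /\ 1 + E x = 1 - theta))].
Proof.
move=> nj rj mS SI Sr /andP[th0 th2] mass.
have Sfin : (mu S < +oo)%E.
  apply: (@le_lt_trans _ _ (mu `[t, T]%classic)); last exact: lebesgue_itv_lty.
  by apply: le_measure; rewrite ?inE//; exact: measurable_itv.
have i1 : mu.-integrable setT (EFin \o (\1_S : R -> R)).
  rewrite (_ : (\1_S : R -> R) = (cst (1 : R) : R -> R) \_ S); last first.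
    by apply/funext => x; rewrite indicE patchE; case: (x \in S).
  rewrite -restrict_EFin; apply/integrable_restrict => //=; rewrite setTI.
  by apply: (bounded_integrable (C := 1)) => // x _; rewrite normr1.
have iS : mu.-integrable setT (EFin \o (fun x => theta * \1_S x)).
  exact: integrableZl_EFin.
pose e x := spike j x - theta * \1_S x.
have me : measurable_fun setT e.
  apply: measurable_funB; first exact: measurable_spike.
  by apply: measurable_funM => //; exact: measurable_indic.
have ie : mu.-integrable setT (EFin \o e).
  by apply: integrableB_EFin => //; exact: integrable_spike.
have intS : \int[mu]_x (theta * \1_S x) = theta * fine (mu S).
  rewrite RintegralZl//.
  by congr (_ * _); rewrite /Rintegral integral_indic// setIT.
have eI x : t <= x <= T -> S x -> e x = - theta.
  move=> xI Sx; rewrite /e spike_in// /spike0 ltNge (le_trans (Sr x Sx))//=.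
  by rewrite indicE mem_set// mulr1 sub0r.
have eN x : ~ S x -> e x = spike j x.
  by move=> Sx; rewrite /e indicE memNset// mulr0 subr0.
have SI' x : S x -> t <= x <= T by move=> /SI; rewrite /= in_itv.
have e_ge x : - 2^-1 <= e x.
  have [Sx|Sx] := pselect (S x); first by rewrite eI ?lerN2//; exact: SI'.
  by rewrite eN//; apply: (le_trans _ (spike_ge0 x nj)); rewrite oppr_le0.
have e_out x : ~ (t <= x <= T) -> e x = 0.
  by move=> xI; rewrite eN ?spike_out// => /SI'.
have e_int : \int[mu]_x e x = spike_mass j - theta * fine (mu S).
  by rewrite /e RintegralB//; [rewrite intS|exact: integrable_spike].
have e_mass : 0 <= \int[mu]_x e x by rewrite e_int subr_ge0.
exists (Perturbation me ie e_ge e_out e_mass); split=> //=.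
- apply: (@le_trans _ _ (\int[mu]_x (spike j x + theta * \1_S x))).
    apply: le_Rintegral => //.
    + exact: integrable_norm.
    + by apply: integrableD_EFin => //; exact: integrable_spike.
    + move=> x _; apply: (le_trans (ler_normB _ _)).
      by rewrite !ger0_norm ?spike_ge0// mulr_ge0.
  rewrite RintegralD//; last exact: integrable_spike.
  by rewrite intS -/(spike_mass j); lra.
- move=> x fj Sx; rewrite eN//; have [xI|xI] := pselect (t <= x <= T).
    by rewrite spike_in// /spike0 ltNge fj.
  exact: spike_out.
- move=> x xI; have [Sx _|Sx] := pselect (S x); first exact: le_trans (Sr x Sx) rj.
  rewrite eN// spike_in// /spike0 leNgt; case: ifP => // jf /eqP.
  rewrite subr_eq0 => /eqP h; have := le_lt_trans nj jf.
  by rewrite -[X in X < _](mul1r nu0) -h divfK ?ltxx// gt_eqF.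
- move=> x xI Ex; have [Sx|Sx] := pselect (S x).
    by right; split=> //; rewrite eI.
  left; move: Ex; rewrite eN// spike_in// /spike0; case: ifP => [jf _|]; last by rewrite eqxx.
  by split; [exact/ltW/(le_lt_trans nj)|ring].
Qed.

End spikes.

Section construction.
Context (R : realType).
Notation mu := (@lebesgue_measure R).

Lemma spike_sequence (t T nu0 r eps : R) (f : R -> R)
    (both : bool) (S : nat -> set R) :
  0 < nu0 -> 0 < eps -> measurable_fun `[t, T] f ->
  (forall x, 0 <= f x) -> mu.-integrable `[t, T] (EFin \o f) ->
  (forall k, measurable (S k)) -> (forall k, S k `<=` `[t, T]) ->
  (forall k x, S k x -> f x <= r) ->
  (both -> forall k, (0 < mu (S k))%E) ->
  (forall x, \forall k \near \oo, ~ S k x) ->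
  exists E : nat -> perturbation t T,
    [/\ \int[mu]_x `|E k x| @[k --> \oo] --> 0,
      (forall k, \int[mu]_x `|E k x| <= eps),
      (forall x, \forall k \near \oo, E k x = 0) &
      (both -> forall k, \int[mu]_x E k x = 0)] /\
    (forall k x, t <= x <= T -> E k x != 0 ->
      (nu0 <= f x /\ 1 + E k x = f x / nu0) \/
      (S k x /\ 2^-1 <= 1 + E k x <= 1)) /\
    (forall k, exists C, forall x, t <= x <= T -> f x / (1 + E k x) <= C).
Proof.
move=> nu00 eps0 mf f0 fi mS SI Sr Spos Sev.
pose delta := spike_mass t T nu0 f.
have dcvg : delta j @[j --> \oo] --> 0 by exact: spike_mass_cvg.
have Sfin k : (mu (S k) < +oo)%E.
  apply: (@le_lt_trans _ _ (mu `[t, T]%classic)); last exact: lebesgue_itv_lty.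
  by apply: le_measure; rewrite ?inE; [exact: mS|exact: measurable_itv|exact: SI].
have E_ex k : exists E : perturbation t T,
   [/\ \int[mu]_x `|E x| <= eps, \int[mu]_x `|E x| <= k.+1%:R^-1,
     (both -> \int[mu]_x E x = 0) &
     (forall x, f x <= k%:R -> ~ S k x -> E x = 0)] /\
   (forall x, t <= x <= T -> E x != 0 ->
      (nu0 <= f x /\ 1 + E x = f x / nu0) \/ (S k x /\ 2^-1 <= 1 + E x <= 1)) /\
   (exists C, forall x, t <= x <= T -> f x / (1 + E x) <= C).
  pose m := fine (mu (S k)).
  (* The target for the gain: the first two halves absorb the factor 2 in the L^1 norm, and m / 2
     makes theta at most 1/2. The 1 is a harmless default. *)
  pose q := Num.min (eps / 2) (Num.min (k.+1%:R^-1 / 2) (if both then m / 2 else 1)).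
  have m0 : both -> 0 < m.
    by move=> bo; apply: fine_gt0; rewrite Spos//=; exact: Sfin.
  have q0 : 0 < q.
    rewrite !lt_min !divr_gt0//=; case: (both) m0 => [m0|_]//.
    by rewrite divr_gt0// m0.
  have : \forall j \near \oo, [/\ r <= j%:R, nu0 <= j%:R, k%:R <= j%:R :> R & `|delta j| <= q].
    move/cvgr0Pnorm_le : dcvg => /(_ q q0) dq.
    near=> j; split; [near: j; exact: nbhs_infty_ger|near: j; exact: nbhs_infty_ger|
      near: j; exact: nbhs_infty_ger|near: j; exact: dq].
  move=> [j _ /(_ j (leqnn j))] [rj nj kj].
  rewrite !le_min => /and3P[dq1 dq2 dq3].
  (* Slowing by theta on a set of measure m gives back exactly the gain delta j. *)
  pose theta := if both then delta j / m else 0.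
  have d0 : 0 <= delta j.
    apply: Rintegral_ge0 => x _; rewrite /spike patchE; case: ifP => // _.
    by case: ifP => // jf; rewrite subr_ge0 ler_pdivlMr// mul1r ltW// (le_lt_trans nj).
  rewrite ger0_norm// in dq1 dq2 dq3.
  have thE : theta * m = if both then delta j else 0.
    by rewrite /theta; case: (both) m0 => [/(_ isT) m0|_]; rewrite ?mul0r// divfK// gt_eqF.
  have th2 : 0 <= theta <= 2^-1.
    rewrite /theta; case: (both) m0 dq3 => [/(_ isT) m0 dm|_ _]; last by rewrite lexx/=.
    by rewrite divr_ge0 ?(ltW m0)//= ler_pdivrMr// mulrC.
  have thm : theta * m <= delta j by rewrite thE; case: (both).
  have [E [E1 E2 E3 E4 E5]] :=
    spike_perturbation nu00 mf f0 fi nj rj (mS k) (SI k) (Sr k) th2 thm.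
  have alt x : t <= x <= T -> E x != 0 ->
      (nu0 <= f x /\ 1 + E x = f x / nu0) \/ (S k x /\ 2^-1 <= 1 + E x <= 1).
    move=> xI Ex; have [|[Sx ->]] := E5 x xI Ex; [by left|right; split=> //].
    by case/andP: th2; lra.
  exists E; split; [split|split=> //].
  - by apply: (le_trans E2); rewrite -/(delta j) mulrC -ler_pdivlMr.
  - by apply: (le_trans E2); rewrite -/(delta j) mulrC -ler_pdivlMr.
  - by move=> bo; rewrite E1 -/m -/(delta j) thE bo subrr.
  - by move=> x fk; apply: E3; exact: le_trans kj.
  (* The speed is at most j where the clock is unperturbed, equals nu0 on the spikes, and is at most
     2r on S k. *)
  - exists (j%:R + nu0 + 2 * `|r|) => x xI.
    have j0 := ler0n R j; have r0 := normr_ge0 r.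
    have [Ex|Ex] := eqVneq (E x) 0.
      by rewrite Ex addr0 divr1; have := E4 x xI Ex; lra.
    have [[nf ->]|[Sx /andP[e1 _]]] := alt x xI Ex.
      rewrite invf_div mulrCA divff ?mulr1; first by lra.
      by rewrite gt_eqF// (lt_le_trans nu00).
    rewrite ler_pdivrMr; last by lra.
    have := Sr k x Sx; have := ler_norm r; have := f0 x; nra.
have [E HE] := choice E_ex.
exists E; split; [split|split].
- apply/cvgr0Pnorm_le => a a0.
  have := near_infty_natSinv_lt (PosNum a0); apply: filterS => k /= ka.
  rewrite ger0_norm ?Rintegral_ge0//; apply: le_trans (ltW ka).
  by case: (HE k) => -[].
- by move=> k; case: (HE k) => -[].
- move=> x; have := @nbhs_infty_ger R (f x); apply: filterS2 (Sev x) => k Sx fk.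
  by case: (HE k) => -[_ _ _ h] _; exact: h.
- by move=> bo k; case: (HE k) => -[_ _ h _] _; exact: h.
- by move=> k; case: (HE k) => _ [].
- by move=> k; case: (HE k) => _ [].
Unshelve. all: by end_near.
Qed.

(** Common core of both statements: S k are the sets available for giving time back, required to
    have positive measure only when both end points are prescribed. *)
Lemma no_gap_of_slow_sets (n : nat) (p t T : R)
    (Lam : R -> 'rV[R]_n -> 'rV[R]_n -> \bar R) (Psi : R -> 'rV[R]_n -> \bar R)
    (y dy : R -> 'rV[R]_n) (both : bool) (S : nat -> set R) (r nu0 M M1 M2 : R) :
  1 <= p -> (0 < n)%N -> t < T ->
  (forall s z u, (0 <= Lam s z u)%E) -> (forall s z, (0 <= Psi s z)%E) ->
  borel_fun_on [set x : R * 'rV[R]_n * 'rV[R]_n | t <= x.1.1 <= T]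
    (fun x => Lam x.1.1 x.1.2 x.2) ->
  borel_fun_on [set x : R * 'rV[R]_n | t <= x.1 <= T] (fun x => Psi x.1 x.2) ->
  (exists D : set ('rV[R]_n * 'rV[R]_n),
     forall s z u, t <= s <= T -> ((Lam s z u < +oo)%E <-> D (z, u))) ->
  condS t T p Lam ->
  W1p t T p y dy ->
  mu.-integrable `[t, T] (fun s => Lam s (y s) (dy s)) ->
  (forall s x, t <= s <= T -> t <= x <= T -> (Psi s (y x) <= M%:E)%E) ->
  (forall x, t <= x <= T -> {within `[t, T], continuous (fun s => Psi s (y x))}) ->
  0 < nu0 ->
  (forall s x u, t <= s <= T -> t <= x <= T -> enorm u <= nu0 ->
    (Lam s (y x) u <= M1%:E)%E) ->
  (forall k, measurable (S k)) -> (forall k, S k `<=` `[t, T]) ->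
  (forall k x, S k x -> enorm (dy x) <= r) ->
  (both -> forall k, (0 < mu (S k))%E) ->
  (forall x, \forall k \near \oo, ~ S k x) ->
  (forall k x s u, S k x -> t <= s <= T -> enorm u <= 2 * r ->
    (Lam s (y x) u <= M2%:E)%E) ->
  no_gap both t T p Lam Psi y dy.
Proof.
move=> p1 n0 tT Lam0 Psi0 mLam mPsi [D hD] hcond yW iLam PsiM cPsi nu00 LamM1
  mS SI Sr Spos Sev LamM2.
have [K HK] := W1p_bounded p1 yW.
have [kappa [beta [gamma [eps [kappa0 [beta0 [igamma [eps0 hS]]]]]]]] :=
  hcond `|K| (normr_ge0 K).
pose f x := enorm (dy x).
have mf : measurable_fun `[t, T] f.
  by apply: measurable_enorm => i; exact: (W1p_measurable yW).
have f0 x : 0 <= f x by exact: enorm_ge0.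
have fi : mu.-integrable `[t, T] (EFin \o f) by exact: (W1p_integrable_enorm p1 yW).
have [E [[Ecvg Esmall Eev Ezero] [Ealt Ebound]]] :=
  spike_sequence nu00 eps0 mf f0 fi mS SI Sr Spos Sev.
(* Dominates both Lam phi' and phi' on the perturbed set: the summand with f serves the spikes,
   where phi' = f/nu0, and the constant serves the slow sets, where phi' <= 1. The added 1's are for
   phi' itself. *)
pose dom x := (`|M1| + 1) * (nu0^-1 * f x) + (`|M2| + 1).
have idom : mu.-integrable `[t, T] (EFin \o dom).
  apply: integrableD_EFin => //.
    by do 2 apply: integrableZl_EFin => //.
  by apply: (bounded_integrable_itv (C := `|(`|M2| + 1)|)).
have q0 x : 0 <= nu0^-1 * f x by rewrite mulr_ge0// invr_ge0 ltW.
have slow k x : t <= x <= T -> E k x != 0 -> enorm (dy x) / (1 + E k x) <= nu0 + 2 * `|r|.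
  move=> xI Ex; have r0 := normr_ge0 r; have [[nf ->]|[Sx /andP[e1 _]]] := Ealt k x xI Ex.
    rewrite -/(f x) invf_div mulrCA divff ?mulr1; first by lra.
    by rewrite gt_eqF// (lt_le_trans nu00).
  rewrite ler_pdivrMr; last by lra.
  have := Sr k x Sx; have := ler_norm r; have := f0 x; rewrite /f; nra.
have fast k x : t <= x <= T -> E k x != 0 -> 1 + E k x <= dom x.
  have M10 := normr_ge0 M1; have M20 := normr_ge0 M2.
  move=> xI Ex; have := q0 x; rewrite /dom; have [[nf ->]|[Sx /andP[_ e1]]] := Ealt k x xI Ex.
    by rewrite [f x / nu0]mulrC; nra.
  nra.
have Lam_dom k x s : t <= x <= T -> t <= s <= T -> E k x != 0 ->
    (Lam s (y x) (slowed dy E k x) * (1 + E k x)%:E <= (dom x)%:E)%E.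
  have M10 := normr_ge0 M1; have M20 := normr_ge0 M2.
  move=> xI sI Ex; have rho0 : 0 <= 1 + E k x by rewrite ltW// one_pert_gt0.
  have [[nf eE]|[Sx /andP[e1 e2]]] := Ealt k x xI Ex.
    have sl : enorm (slowed dy E k x) <= nu0.
      rewrite enorm_slowed eE -/(f x) invf_div mulrCA divff ?mulr1//.
      by rewrite gt_eqF// (lt_le_trans nu00).
    apply: (@le_trans _ _ (M1%:E * (1 + E k x)%:E)%E).
      by rewrite lee_wpmul2r ?lee_fin// LamM1.
    rewrite -EFinM lee_fin eE [f x / nu0]mulrC /dom.
    have := ler_norm M1; have := q0 x; nra.
  have sl : enorm (slowed dy E k x) <= 2 * r.
    rewrite enorm_slowed ler_pdivrMr; last by lra.
    have := Sr k x Sx; have := f0 x; rewrite /f; nra.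
  apply: (@le_trans _ _ (M2%:E * (1 + E k x)%:E)%E).
    by rewrite lee_wpmul2r ?lee_fin// (LamM2 k).
  rewrite -EFinM lee_fin /dom.
  have := ler_norm M2; have := q0 x; nra.
have fin_indep s s' z u : t <= s <= T -> t <= s' <= T ->
    (Lam s z u < +oo)%E -> (Lam s' z u < +oo)%E.
  by move=> sI s'I /(hD s z u sI) ?; exact/(hD s' z u s'I).
have M0 : 0 <= M.
  have tI : t <= t <= T by rewrite lexx ltW.
  by have := PsiM t t tI tI; rewrite -lee_fin; apply: le_trans; exact: Psi0.
have hS' : {ae mu, forall s, t <= s <= T -> (Lam s (y s) (dy s) < +oo)%E ->
     forall s2, `|s2 - s| <= eps -> t <= s2 <= T ->
     (`|Lam s2 (y s) (dy s) - Lam s (y s) (dy s)| <=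
       (kappa%:E * Lam s (y s) (dy s) + (beta * enorm (dy s) `^ p + gamma s)%:E)
         * `|s2 - s|%:E)%E}.
  apply: (@filterS _ _ (ae_filter_ringOfSetsType mu) _ _ _ hS) => s hs sI Lfin s2.
  rewrite ler_norml => /andP[h1 h2] s2I; apply: hs => //.
  - by apply/andP; split; lra.
  - by apply/andP; split; lra.
  - by apply: le_trans (ler_norm K); exact: HK.
have Fcvg := energy_cvg mLam mPsi Lam0 Psi0 p1 n0 tT yW Ecvg Eev Esmall idom iLam
  fin_indep kappa0 beta0 igamma M0 hS' PsiM cPsi Lam_dom.
exists (arc y E), (arc_deriv dy E); split; first exact: (arc_lipschitz p1 yW Ebound).
split; first exact: (arc_W1p p1 yW Ebound).
split; first by move=> k; exact: arc_left.
split; first by move=> bo k; apply: arc_right; exact: Ezero.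
split; last exact: (arc_W1p_cvg p1 n0 tT yW Ecvg Eev idom slow fast).
(* The energies converge, so their limsup is the limit. *)
by rewrite is_cvg_limn_esupE; [exact/cvg_lim|apply/cvg_ex; eexists; exact: Fcvg].
Qed.

End construction.

(** * Finding room for the slow sets, and conclusion *)

Lemma W1p_open_itv (R : realType) (n : nat) (t T p : R) (y dy : R -> 'rV[R]_n)
    (V : set 'rV[R]_n) (s0 : R) :
  1 <= p -> t < T -> W1p t T p y dy -> open V -> t <= s0 <= T -> V (y s0) ->
  exists c d, [/\ t <= c, c < d, d <= T & forall x, c <= x <= d -> V (y x)].
Proof.
move=> p1 tT yW oV s0I Vs0; have /andP[ts sT] := s0I.
have /nbhs_ballP[e /= e0 eV] : nbhs (y s0) V by exact: open_nbhs_nbhs.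
have s0I' : `[t, T]%classic s0 by rewrite /= in_itv.
have near_i i : \forall x \near within `[t, T] (nbhs s0),
    ball (y s0 ord0 i) e (y x ord0 i).
  have /subspace_continuousP/(_ s0 s0I') ci :
    {within `[t, T], continuous (fun s => y s ord0 i)} by exact: (W1p_continuous p1 (ltW tT) yW).
  exact: (ci _ (nbhsx_ballx (y s0 ord0 i) e e0)).
have : \forall x \near within `[t, T] (nbhs s0),
    forall i, ball (y s0 ord0 i) e (y x ord0 i).
  by apply: filter_forall; exact: near_i.
rewrite near_withinE => /nbhs_ballP[d /= d0 dV].
exists (Num.max t (s0 - d / 2)), (Num.min T (s0 + d / 2)); split.
- by rewrite le_max lexx.
- by rewrite gt_max !lt_min tT; apply/andP; split; apply/andP; split=> //; lra.
- by rewrite ge_min lexx.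
- move=> x; rewrite ge_max le_min => /andP[/andP[tx xl] /andP[xT xr]].
  apply: eV; apply/ball_rowE => // i; apply: dV.
    by rewrite -ball_normE/= ltr_norml; apply/andP; split; lra.
  by rewrite /= in_itv/= tx xT.
Qed.

(** The interval [c, d] is the countable union of the sets where |y'| <= m, so one of them has
    positive measure. *)
Lemma W1p_slow_set (R : realType) (n : nat) (t T p : R) (y dy : R -> 'rV[R]_n)
    (c d : R) : W1p t T p y dy -> t <= c -> c < d -> d <= T ->
  exists (m : nat) (A : set R), [/\ measurable A, A `<=` `[c, d],
    (0 < lebesgue_measure A)%E & forall x, A x -> enorm (dy x) <= m%:R].
Proof.
move=> yW tc cd dT.
pose A (m : nat) := `[c, d]%classic `&` (fun x => enorm (dy x) <= m%:R) @^-1` [set true].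
have mA m : measurable (A m).
  apply: measurable_fun_ler => //.
  apply: (measurable_funS (measurable_itv `[t, T])).
    by apply: subset_itv; rewrite bnd_simp.
  by apply: measurable_enorm => i; exact: (W1p_measurable yW).
have [m Am] : exists m, (0 < lebesgue_measure (A m))%E.
  apply: lebesgue_bigcup_gt0 => //; rewrite (_ : \bigcup_m A m = `[c, d]%classic).
    by rewrite lebesgue_measure_itv/= lte_fin cd -EFinB lte_fin subr_gt0.
  apply/seteqP; split=> x; first by case=> m _ [].
  move=> xI; have [m _ hm] := @nbhs_infty_ger R (enorm (dy x)).
  by exists m => //; split=> //=; exact: hm (leqnn m).
by exists m, (A m); split=> // x [].
Qed.

Unset Implicit Arguments.

Theorem theorem3p1 (R : realType) (n : nat) (p t T : R)
  (Lam : R -> 'rV[R]_n -> 'rV[R]_n -> \bar R) (Psi : R -> 'rV[R]_n -> \bar R)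
  (y dy : R -> 'rV[R]_n) :
  1 <= p -> (0 < n)%N -> t < T ->
  (forall s z u, (0 <= Lam s z u)%E) -> (forall s z, (0 <= Psi s z)%E) ->
  borel_fun_on [set x : R * 'rV[R]_n * 'rV[R]_n | t <= x.1.1 <= T]
    (fun x => Lam x.1.1 x.1.2 x.2) ->
  borel_fun_on [set x : R * 'rV[R]_n | t <= x.1 <= T] (fun x => Psi x.1 x.2) ->
  (exists D : set ('rV[R]_n * 'rV[R]_n),
     forall s z u, t <= s <= T -> ((Lam s z u < +oo)%E <-> D (z, u))) ->
  condS t T p Lam ->
  W1p t T p y dy ->
  lebesgue_measure.-integrable `[t, T] (fun s => (Lam s (y s) (dy s) * Psi s (y s))%E) ->
  lebesgue_measure.-integrable `[t, T] (fun s => Lam s (y s) (dy s)) ->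
  (exists O : set 'rV[R]_n,
     [/\ open O, y @` `[t, T] `<=` O,
       (exists M : R, forall s z, t <= s <= T -> O z -> (Psi s z <= M%:E)%E),
       (forall z, (y @` `[t, T]) z -> {within `[t, T], continuous (fun s => Psi s z)}) &
       (exists nu0 : R, 0 < nu0 /\ exists M : R,
          forall s z u, t <= s <= T -> O z -> enorm u <= nu0 -> (Lam s z u <= M%:E)%E)]) ->
  no_gap false t T p Lam Psi y dy /\
  ((exists U : set 'rV[R]_n,
      [/\ U !=set0, U `<=` y @` `[t, T],
        (exists V : set 'rV[R]_n, open V /\ U = V `&` (y @` `[t, T])) &
        (forall r : R, 0 < r -> exists M : R,
           forall s z u, t <= s <= T -> U z -> enorm u <= r -> (Lam s z u <= M%:E)%E)]) ->
   no_gap true t T p Lam Psi y dy).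
Proof.
move=> p1 n0 tT Lam0 Psi0 mLam mPsi hD hcond yW _ iLam
  [W [oW yO [M HM] cPsi [nu0 [nu00 [M1 HM1]]]]].
have yI x : t <= x <= T -> (y @` `[t, T]) (y x).
  by move=> xI; exists x => //; rewrite /= in_itv.
have PsiM s x : t <= s <= T -> t <= x <= T -> (Psi s (y x) <= M%:E)%E.
  by move=> sI xI; apply: HM => //; apply: yO; exact: yI.
have cPsi' x : t <= x <= T -> {within `[t, T], continuous (fun s => Psi s (y x))}.
  by move=> xI; apply: cPsi; exact: yI.
have LamM1 s x u : t <= s <= T -> t <= x <= T -> enorm u <= nu0 ->
    (Lam s (y x) u <= M1%:E)%E.
  by move=> sI xI; apply: HM1 => //; apply: yO; exact: yI.
split.
  (* With a free right end point no time has to be given back. *)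
  apply: (no_gap_of_slow_sets (S := fun=> set0) (r := 0) (M2 := 0) p1 n0 tT Lam0 Psi0
    mLam mPsi hD hcond yW iLam PsiM cPsi' nu00 LamM1) => //.
    by move=> _; exact: sub0set.
  by move=> x; apply: nearW => _ [].
move=> [U [[z0 Uz0] Uy [V [oV UE]] HU]].
have [s0 s0I s0z] := Uy _ Uz0; rewrite /= in_itv/= in s0I.
have Vs0 : V (y s0) by move: Uz0; rewrite UE s0z => -[].
have [c [d [tc cd dT cdV]]] := W1p_open_itv p1 tT yW oV s0I Vs0.
have [m [A [mA Acd A0 Am]]] := W1p_slow_set yW tc cd dT.
have [S [mS SA Spos Sev]] := shrinking_sets mA Acd A0.
have AI x : A x -> t <= x <= T.
  move=> /Acd; rewrite /= in_itv/= => /andP[cx xd].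
  by rewrite (le_trans tc)//= (le_trans xd).
(* On the slow sets speeds reach at most 2m; the extra 1 makes the radius positive even for m =
   0. *)
have [|M2 HM2] := HU (2 * m%:R + 1); first by rewrite ltr_wpDl// mulr_ge0.
apply: (no_gap_of_slow_sets (S := S) (r := m%:R) (M2 := M2) p1 n0 tT Lam0 Psi0
  mLam mPsi hD hcond yW iLam PsiM cPsi' nu00 LamM1) => //.
- by move=> k x /SA /AI xI; rewrite /= in_itv.
- by move=> k x /SA; exact: Am.
- move=> k x s u /SA Ax sI um; apply: HM2 => //.
    rewrite UE; split; last exact/yI/AI.
    by apply: cdV; have := Acd x Ax; rewrite /= in_itv.
  by apply: (le_trans um); rewrite lerDl.
Qed.
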